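(* Let $M>0$ and $\alpha\in(0,1]$ satisfy $M-\alpha+1\leq \frac{3(1+\alpha)}{6\alpha+4}$. If $F_1,F_2\in\mathcal{P}_{\mathcal{H}}^0(\alpha,M)$, then $F_1*F_2\in\mathcal{P}_{\mathcal{H}}^0(\alpha,M)$.
   Context: $\mathbb{D}=\{z\in\mathbb{C}:|z|<1\}$. $\mathcal{H}$ is the class of complex-valued harmonic functions $f=h+\overline{g}$ in $\mathbb{D}$, with $h,g$ analytic in $\mathbb{D}$ and $h(0)=h'(0)-1=0$, $g(0)=0$. For $M>0$ and $\alpha\in(0,1]$, $\mathcal{P}_{\mathcal{H}}^0(\alpha,M)$ is the class of all $f=h+\overline{g}\in\mathcal{H}$ with $g'(0)=0$ and $$\mathrm{Re}\left((1-\alpha)h'(z)+\alpha zh''(z)\right)>-M+\left|(1-\alpha)g'(z)+\alpha zg''(z)\right|\quad\text{for all } z\in\mathbb{D}.$$ The convolution (Hadamard product) of analytic functions $\psi_1(z)=\sum_{n\ge0}a_nz^n$ and $\psi_2(z)=\sum_{n\ge0}b_nz^n$ in $\mathbb{D}$ is $(\psi_1*\psi_2)(z)=\sum_{n\ge0}a_nb_nz^n$. For $f_1=h_1+\overline{g_1}$ and $f_2=h_2+\overline{g_2}$ in $\mathcal{H}$, the convolution is $f_1*f_2=h_1*h_2+\overline{g_1*g_2}$. *)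

(* Defs.v *)
From Stdlib Require Import Reals ClassicalEpsilon.
From Coquelicot Require Import Coquelicot.

Local Open Scope C_scope.

(* A function on the open unit disc is represented by a total function C -> C;
   its values outside the disc are irrelevant. *)
Definition unit_disc (z : C) : Prop := (Cmod z < 1)%R.

Definition analytic_at (f : C -> C) (z0 : C) : Prop :=
  exists (a : nat -> C) (r : R), (0 < r)%R /\
    forall z : C, (Cmod (z - z0) < r)%R -> is_pseries a (z - z0) (f z).

Definition analytic_in_disc (f : C -> C) : Prop :=
  forall z0 : C, unit_disc z0 -> analytic_at f z0.

(* [C_derive] is total; it is the complex derivative wherever that exists, in
   particular at every point of the disc when h and g are analytic there. *)
Definition harmonic_decomp (f h g : C -> C) : Prop :=
  analytic_in_disc h /\ analytic_in_disc g /\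
  h 0 = 0 /\ C_derive h 0 = 1 /\ g 0 = 0 /\
  forall z : C, unit_disc z -> f z = h z + Cconj (g z).

Definition class_H (f : C -> C) : Prop :=
  exists h g : C -> C, harmonic_decomp f h g.

Definition class_P0H (alpha M : R) (f : C -> C) : Prop :=
  exists h g : C -> C,
    harmonic_decomp f h g /\ C_derive g 0 = 0 /\
    forall z : C, unit_disc z ->
      (Re (RtoC (1 - alpha) * C_derive h z
           + RtoC alpha * z * C_derive (C_derive h) z)
       > - M + Cmod (RtoC (1 - alpha) * C_derive g z
                     + RtoC alpha * z * C_derive (C_derive g) z))%R.

(* The coefficients a_n in psi(z) = sum_n a_n z^n on the disc: they exist and
   are unique when psi is analytic in the disc, and are unspecified otherwise. *)
Definition disc_coeffs (psi : C -> C) : nat -> C :=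
  epsilon (inhabits (fun _ : nat => RtoC 0))
    (fun a => forall z : C, unit_disc z -> is_pseries a z (psi z)).

(* The sum of the series, where it converges; unspecified elsewhere. *)
Definition CPSeries (a : nat -> C) (z : C) : C :=
  iota (T := CompleteNormedModule.CompleteSpace _ C_CompleteNormedModule)
    (fun l : C => is_pseries a z l).

Definition hadamard (psi1 psi2 : C -> C) (z : C) : C :=
  CPSeries (fun n => disc_coeffs psi1 n * disc_coeffs psi2 n) z.

(* The pair (h, g) with f = h + conj g. On the disc it is determined by f when
   f belongs to class_H, because g 0 = 0; otherwise it is unspecified. *)
Definition parts (f : C -> C) : (C -> C) * (C -> C) :=
  epsilon (inhabits (fun _ : C => RtoC 0, fun _ : C => RtoC 0))
    (fun hg => harmonic_decomp f (fst hg) (snd hg)).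

Definition hconv (f1 f2 : C -> C) (z : C) : C :=
  hadamard (fst (parts f1)) (fst (parts f2)) z
  + Cconj (hadamard (snd (parts f1)) (snd (parts f2)) z).

(* Main.v *)
Require Import Defs.
From Stdlib Require Import Reals.
From Coquelicot Require Import Coquelicot.
From Stdlib Require Import Lra Lia ClassicalEpsilon Classical.

(** Put k = M - alpha + 1 and w_n = (n+1)(1 + alpha(n-1)).  If h and g have
    coefficients a_n and b_n, membership in the class says that, for every
    unimodular e, the function u_e(z) = k + sum_{n>=1} w_n (a_{n+1} + e b_{n+1}) z^n
    has positive real part in the disc.  Writing A_i + e B_i for the sequence
    w_n (a_{n+1} + e b_{n+1}) belonging to the i-th function, from
      (A1 + B1)(A2 + e B2) + (A1 - B1)(A2 - e B2) = 2 (A1 A2 + e B1 B2)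
    it is enough to convolve two such functions u, v and to divide the
    coefficients by w_n.  Regarding Re u as a trigonometric series with
    coefficients u_n / 2, this amounts to multiplying the coefficients of three
    nonnegative trigonometric series, the third one having c_0 = 1 and
    c_n = 2k / w_n; its nonnegativity is Fejer's theorem, since the hypothesis on
    M and alpha is exactly the convexity condition 1 - 2 c_1 + c_2 >= 0.
    Replacing c_n by c_n s^n with s < 1 leaves room to lower c_0, which makes the
    final inequality strict.

    That coefficientwise products preserve nonnegativity is seen by averaging over
    roots of unity.  The same averages give the Cauchy estimates from which a
    function analytic in the disc is shown, without integration, to be the sum of
    its Taylor series: if its radius R were less than 1, compactness would bound all
    derivatives on |z| < R by m! C rho^-m, and the Cauchy estimates for these
    derivatives would enlarge the radius. *)

Local Open Scope R_scope.

(** * Series and power series over the complex numbers *)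

(* [ring] on [C] when the type of the equation is a Coquelicot structure over [C]. *)
Ltac cring := match goal with |- @eq _ ?a ?b => change (@eq C a b); ring end.

Lemma is_series_C_eps (x : nat -> C) (l : C) :
  is_series x l <->
  (forall e : R, 0 < e -> exists N, forall n, (N <= n)%nat -> Cmod (sum_n x n - l)%C < e).
Proof.
unfold is_series; split.
- intros H e He.
  assert (H1 := proj1 (filterlim_locally_ball_norm (K := C_AbsRing)
    (U := C_NormedModule) (sum_n x) l) H (mkposreal e He)).
  destruct H1 as [N HN]; exists N; intros n Hn; exact (HN n Hn).
- intros H.
  apply (proj2 (filterlim_locally_ball_norm (K := C_AbsRing)
    (U := C_NormedModule) (sum_n x) l)).
  intros e; destruct (H e (cond_pos e)) as [N HN].
  exists N; intros n Hn; exact (HN n Hn).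
Qed.

Lemma is_series_R_eps (x : nat -> R) (l : R) :
  is_series x l <->
  (forall e : R, 0 < e -> exists N, forall n, (N <= n)%nat -> Rabs (sum_n x n - l) < e).
Proof.
unfold is_series; split.
- intros H e He.
  assert (H1 := proj1 (filterlim_locally_ball_norm (K := R_AbsRing)
    (U := R_NormedModule) (sum_n x) l) H (mkposreal e He)).
  destruct H1 as [N HN]; exists N; intros n Hn; exact (HN n Hn).
- intros H.
  apply (proj2 (filterlim_locally_ball_norm (K := R_AbsRing)
    (U := R_NormedModule) (sum_n x) l)).
  intros e; destruct (H e (cond_pos e)) as [N HN].
  exists N; intros n Hn; exact (HN n Hn).
Qed.

Lemma is_series_C_unique (x : nat -> C) (l l' : C) :
  is_series x l -> is_series x l' -> l = l'.
Proof. intros H H'; exact (filterlim_locally_unique _ _ _ H H'). Qed.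

Lemma pow_n_C (z : C) (n : nat) : pow_n z n = (z ^ n)%C.
Proof.
induction n as [|n IH]; [reflexivity|].
exact (f_equal (Cmult z) IH).
Qed.

Lemma is_pseries_C (a : nat -> C) (z l : C) :
  is_pseries a z l <-> is_series (fun n => a n * z ^ n)%C l.
Proof.
assert (E : forall n, scal (pow_n z n) (a n) = (a n * z ^ n)%C).
{ intros n; rewrite (Cmult_comm (a n)).
  exact (f_equal (fun w => (w * a n)%C) (pow_n_C z n)). }
split; apply is_series_ext; intros n; [|symmetry]; apply E.
Qed.

Lemma is_pseries_C_unique (a : nat -> C) (z l l' : C) :
  is_pseries a z l -> is_pseries a z l' -> l = l'.
Proof. apply is_series_C_unique. Qed.

Lemma CPSeries_unique (a : nat -> C) (z l : C) :
  is_pseries a z l -> CPSeries a z = l.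
Proof.
intros H; unfold CPSeries.
apply (iota_unique (K := C_AbsRing) (V := C_CompleteNormedModule)); [|exact H].
intros y Hy; exact (is_pseries_C_unique _ _ _ _ Hy H).
Qed.

Definition abs_summable (a : nat -> C) (r : R) : Prop :=
  ex_series (fun n => Cmod (a n) * r ^ n).

Lemma ex_series_C_abs (x : nat -> C) (b : nat -> R) :
  (forall n, Cmod (x n) <= b n) -> ex_series b -> exists l : C, is_series x l.
Proof.
intros H Hb.
exact (ex_series_le (K := C_AbsRing) (V := C_CompleteNormedModule) x b H Hb).
Qed.

Lemma CPSeries_correct (a : nat -> C) (r : R) (z : C) :
  abs_summable a r -> Cmod z <= r -> is_pseries a z (CPSeries a z).
Proof.
intros Ha Hz.
destruct (ex_series_C_abs (fun n => a n * z ^ n)%C (fun n => Cmod (a n) * r ^ n))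
  as [l Hl].
- intros n; rewrite Cmod_mult, Cmod_pow.
  apply Rmult_le_compat_l; [apply Cmod_ge_0|].
  apply pow_incr; split; [apply Cmod_ge_0|exact Hz].
- exact Ha.
- apply is_pseries_C in Hl.
  rewrite (CPSeries_unique _ _ _ Hl); exact Hl.
Qed.

Lemma sum_n_C_S (x : nat -> C) (n : nat) : sum_n x (S n) = (sum_n x n + x (S n))%C.
Proof. exact (sum_Sn x n). Qed.

Lemma sum_n_R_S (x : nat -> R) (n : nat) : sum_n x (S n) = sum_n x n + x (S n).
Proof. exact (sum_Sn x n). Qed.

Lemma Cmod_sum_n_diff (x : nat -> C) (b : nat -> R) (D n : nat) :
  (forall k, Cmod (x k) <= b k) ->
  (D <= n)%nat -> Cmod (sum_n x n - sum_n x D)%C <= sum_n b n - sum_n b D.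
Proof.
intros H; induction 1 as [|n Hn IH].
- replace (sum_n x D - sum_n x D)%C with (RtoC 0) by ring.
  rewrite Cmod_0; lra.
- rewrite sum_n_C_S, sum_n_R_S.
  replace (sum_n x n + x (S n) - sum_n x D)%C
    with ((sum_n x n - sum_n x D) + x (S n))%C by ring.
  generalize (Cmod_triangle (sum_n x n - sum_n x D) (x (S n))) (H (S n)); lra.
Qed.

Lemma Cmod_sum_n (x : nat -> C) (b : nat -> R) (n : nat) :
  (forall k, (k <= n)%nat -> Cmod (x k) <= b k) -> Cmod (sum_n x n) <= sum_n b n.
Proof.
induction n as [|n IH]; intros H.
- rewrite !sum_O; apply H; lia.
- rewrite sum_n_C_S, sum_n_R_S.
  generalize (Cmod_triangle (sum_n x n) (x (S n))) (H (S n) (le_n _)).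
  assert (Cmod (sum_n x n) <= sum_n b n) by (apply IH; intros; apply H; lia).
  lra.
Qed.

Lemma is_series_tail (x : nat -> C) (b : nat -> R) (l : C) (s : R) (D : nat) :
  (forall k, Cmod (x k) <= b k) -> is_series x l -> is_series b s ->
  Cmod (l - sum_n x D)%C <= s - sum_n b D.
Proof.
intros H Hx Hb; apply le_epsilon; intros e He.
destruct (proj1 (is_series_C_eps _ _) Hx (e / 2)) as [N1 H1]; [lra|].
destruct (proj1 (is_series_R_eps _ _) Hb (e / 2)) as [N2 H2]; [lra|].
set (n := (N1 + N2 + D)%nat).
specialize (H1 n ltac:(unfold n; lia)); specialize (H2 n ltac:(unfold n; lia)).
assert (H3 := Cmod_sum_n_diff x b D n H ltac:(unfold n; lia)).
replace (l - sum_n x D)%C with (- (sum_n x n - l) + (sum_n x n - sum_n x D))%C by ring.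
apply Rle_trans with (1 := Cmod_triangle _ _); rewrite Cmod_opp.
apply Rabs_def2 in H2; lra.
Qed.

Lemma is_series_Cmod_le (x : nat -> C) (b : nat -> R) (l : C) (s : R) :
  (forall k, Cmod (x k) <= b k) -> is_series x l -> is_series b s -> Cmod l <= s.
Proof.
intros H Hx Hb; apply le_epsilon; intros e He.
destruct (proj1 (is_series_C_eps _ _) Hx (e / 2)) as [N1 H1]; [lra|].
destruct (proj1 (is_series_R_eps _ _) Hb (e / 2)) as [N2 H2]; [lra|].
set (n := (N1 + N2)%nat).
specialize (H1 n ltac:(unfold n; lia)); specialize (H2 n ltac:(unfold n; lia)).
assert (H3 := Cmod_sum_n x b n (fun k _ => H k)).
replace l with (- (sum_n x n - l) + sum_n x n)%C by ring.
apply Rle_trans with (1 := Cmod_triangle _ _); rewrite Cmod_opp.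
apply Rabs_def2 in H2; lra.
Qed.

Lemma CPSeries_le (a : nat -> C) (r : R) (z : C) :
  abs_summable a r -> Cmod z <= r ->
  Cmod (CPSeries a z) <= Series (fun n => Cmod (a n) * r ^ n).
Proof.
intros Ha Hz.
apply (is_series_Cmod_le (fun n => a n * z ^ n)%C (fun n => Cmod (a n) * r ^ n)).
- intros n; rewrite Cmod_mult, Cmod_pow.
  apply Rmult_le_compat_l; [apply Cmod_ge_0|].
  apply pow_incr; split; [apply Cmod_ge_0|exact Hz].
- apply is_pseries_C, (CPSeries_correct a r z Ha Hz).
- apply Series_correct, Ha.
Qed.

Lemma ex_series_R_le (a b : nat -> R) :
  (forall n, 0 <= a n <= b n) -> ex_series b -> ex_series a.
Proof.
intros H; apply (ex_series_le (K := R_AbsRing) (V := R_CompleteNormedModule)).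
intros n; change (Rabs (a n) <= b n).
rewrite Rabs_pos_eq; apply H.
Qed.

Lemma abs_summable_le (a : nat -> C) (r r' : R) :
  0 <= r' <= r -> abs_summable a r -> abs_summable a r'.
Proof.
intros Hr; apply ex_series_R_le; intros n; split.
- apply Rmult_le_pos; [apply Cmod_ge_0|apply pow_le; lra].
- apply Rmult_le_compat_l; [apply Cmod_ge_0|apply pow_incr; exact Hr].
Qed.

Lemma abs_summable_of_bound (a : nat -> C) (B r r' : R) :
  0 <= r < r' -> (forall n, Cmod (a n) * r' ^ n <= B) -> abs_summable a r.
Proof.
intros Hr H; apply (ex_series_R_le _ (fun n => B * (r / r') ^ n)).
- intros n; split.
  + apply Rmult_le_pos; [apply Cmod_ge_0|apply pow_le; lra].
  + replace (Cmod (a n) * r ^ n) with (Cmod (a n) * r' ^ n * (r / r') ^ n).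
    * apply Rmult_le_compat_r; [apply pow_le, Rdiv_le_0_compat; lra|apply H].
    * rewrite Rmult_assoc, <- Rpow_mult_distr; do 2 f_equal; field; lra.
- apply (ex_series_scal (K := R_AbsRing) (V := R_NormedModule) B).
  apply ex_series_geom.
  rewrite Rabs_pos_eq by (apply Rdiv_le_0_compat; lra).
  apply (Rdiv_lt_1 r r'); lra.
Qed.

Lemma sum_n_R_mono (b : nat -> R) (m n : nat) :
  (forall k, 0 <= b k) -> (m <= n)%nat -> sum_n b m <= sum_n b n.
Proof.
intros Hb; induction 1 as [|n Hn IH]; [lra|].
rewrite sum_n_R_S; generalize (Hb (S n)); lra.
Qed.

Lemma sum_n_R_le_Series (b : nat -> R) (n : nat) :
  (forall k, 0 <= b k) -> ex_series b -> sum_n b n <= Series b.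
Proof.
intros Hb He.
apply Series_correct in He; set (s := Series b) in *; clearbody s.
apply le_epsilon; intros e Hep.
destruct (proj1 (is_series_R_eps _ _) He e Hep) as [N HN].
specialize (HN (n + N)%nat ltac:(lia)); apply Rabs_def2 in HN.
generalize (sum_n_R_mono b n (n + N) Hb ltac:(lia)); lra.
Qed.

Lemma term_le_sum_n (b : nat -> R) (n : nat) :
  (forall k, 0 <= b k) -> b n <= sum_n b n.
Proof.
intros Hb; destruct n as [|n]; [rewrite sum_O; lra|].
rewrite sum_n_R_S; generalize (cond_pos_sum b n Hb); rewrite <- sum_n_Reals; lra.
Qed.

Lemma term_le_Series (b : nat -> R) (n : nat) :
  (forall k, 0 <= b k) -> ex_series b -> b n <= Series b.
Proof.
intros Hb He; apply Rle_trans with (1 := term_le_sum_n b n Hb).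
apply sum_n_R_le_Series; assumption.
Qed.

(** Abel's lemma: the terms of a convergent series are bounded, and passing to a smaller radius
    turns the bound into a geometric majorant. *)
Lemma is_pseries_abs_summable (a : nat -> C) (z l : C) (r : R) :
  is_pseries a z l -> 0 <= r < Cmod z -> abs_summable a r.
Proof.
intros H Hr; apply is_pseries_C in H.
assert (HB : exists B, forall n, Cmod (a n) * Cmod z ^ n <= B).
{ destruct (proj1 (is_series_C_eps _ _) H 1) as [N HN]; [lra|].
  set (b := fun n => Cmod (a n) * Cmod z ^ n).
  assert (Hb : forall k, 0 <= b k).
  { intros k; apply Rmult_le_pos; [apply Cmod_ge_0|apply pow_le, Cmod_ge_0]. }
  (* Past [N] a term is the difference of two partial sums within 1 of [l], hence at most 2; the
     earlier terms are at most their sum. *)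
  exists (Rmax 2 (sum_n b N)); intros n.
  destruct (Nat.le_gt_cases n N) as [Hn|Hn].
  - apply Rle_trans with (2 := Rmax_r _ _).
    change (b n <= sum_n b N).
    apply Rle_trans with (1 := term_le_sum_n b n Hb).
    apply sum_n_R_mono; assumption.
  - apply Rle_trans with (2 := Rmax_l _ _).
    destruct n as [|n]; [lia|].
    assert (H1 := HN n ltac:(lia)); assert (H2 := HN (S n) ltac:(lia)).
    rewrite <- Cmod_pow, <- Cmod_mult.
    rewrite sum_n_C_S in H2.
    replace (a (S n) * z ^ S n)%C with
      ((sum_n (fun n => a n * z ^ n)%C n + a (S n) * z ^ S n - l)
       + - (sum_n (fun n => a n * z ^ n)%C n - l))%C by ring.
    apply Rle_trans with (1 := Cmod_triangle _ _); rewrite Cmod_opp; lra. }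
destruct HB as [B HB].
apply (abs_summable_of_bound a B r (Cmod z)); assumption.
Qed.

Lemma RtoC_neq_0 (t : R) : t <> 0 -> RtoC t <> 0%C.
Proof. intros H E; apply H, RtoC_inj, E. Qed.

Lemma Cmod_R_pos (t : R) : 0 <= t -> Cmod t = t.
Proof. intros H; rewrite Cmod_R; apply Rabs_pos_eq, H. Qed.

Lemma abs_summable_of_disc (a : nat -> C) (f : C -> C) (r s : R) :
  0 <= s < r -> (forall v : C, Cmod v < r -> v <> RtoC 0 -> is_pseries a v (f v)) ->
  abs_summable a s.
Proof.
intros Hs H; set (t := (s + r) / 2).
apply (is_pseries_abs_summable a (RtoC t) (f (RtoC t))); unfold t.
- apply H; [rewrite Cmod_R_pos; lra|apply RtoC_neq_0; lra].
- rewrite Cmod_R_pos; lra.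
Qed.

Definition const_coef (c : C) (n : nat) : C := match n with O => c | S _ => RtoC 0 end.

Lemma is_pseries_const (c z : C) : is_pseries (const_coef c) z c.
Proof.
apply is_pseries_C, is_series_C_eps; intros e He; exists 0%nat; intros n _.
replace (sum_n (fun n => const_coef c n * z ^ n)%C n) with c.
- replace (c - c)%C with (RtoC 0) by ring; rewrite Cmod_0; exact He.
- induction n as [|n IH].
  + rewrite sum_O; simpl; cring.
  + rewrite sum_n_C_S, <- IH; simpl const_coef; cring.
Qed.

Lemma is_pseries_C_ext (a b : nat -> C) (z l : C) :
  (forall n, a n = b n) -> is_pseries a z l -> is_pseries b z l.
Proof.
intros H; unfold is_pseries; apply is_series_ext; intros n; rewrite H; reflexivity.
Qed.

Lemma is_pseries_at_0 (a : nat -> C) (l : C) : is_pseries a (RtoC 0) l -> l = a 0%nat.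
Proof.
intros H; apply is_pseries_C in H.
assert (H0 := is_pseries_const (a 0%nat) 0%C); apply is_pseries_C in H0.
apply (is_series_C_unique _ _ _ H); apply is_series_ext with (2 := H0).
intros [|k]; simpl; cring.
Qed.

Lemma is_pseries_C_minus (a b : nat -> C) (v l l' : C) :
  is_pseries a v l -> is_pseries b v l' ->
  is_pseries (fun n => a n - b n)%C v (l - l')%C.
Proof.
intros Ha Hb; apply is_pseries_C in Ha; apply is_pseries_C in Hb; apply is_pseries_C.
apply is_series_ext with (fun n => a n * v ^ n - b n * v ^ n)%C.
- intros n; cring.
- exact (is_series_minus _ _ _ _ Ha Hb).
Qed.

Lemma is_pseries_C_plus (a b : nat -> C) (v l l' : C) :
  is_pseries a v l -> is_pseries b v l' ->
  is_pseries (fun n => a n + b n)%C v (l + l')%C.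
Proof.
intros Ha Hb; apply is_pseries_C in Ha; apply is_pseries_C in Hb; apply is_pseries_C.
apply is_series_ext with (fun n => a n * v ^ n + b n * v ^ n)%C.
- intros n; cring.
- exact (is_series_plus _ _ _ _ Ha Hb).
Qed.

Lemma is_pseries_C_scal (c : C) (a : nat -> C) (v l : C) :
  is_pseries a v l -> is_pseries (fun n => c * a n)%C v (c * l)%C.
Proof.
intros Ha; apply is_pseries_C in Ha; apply is_pseries_C.
apply is_series_ext with (fun n => c * (a n * v ^ n))%C.
- intros n; cring.
- exact (is_series_scal (K := C_AbsRing) (V := C_NormedModule) c _ _ Ha).
Qed.

(** * Re-expansion of a power series at another point *)

Lemma ex_series_bounded (b : nat -> R) (B : R) :
  (forall k, 0 <= b k) -> (forall n, sum_n b n <= B) ->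
  ex_series b /\ Series b <= B.
Proof.
intros Hb HB.
assert (He : ex_finite_lim_seq (sum_n b)).
{ apply ex_finite_lim_seq_incr with B; [|exact HB].
  intros n; rewrite sum_n_R_S; generalize (Hb (S n)); lra. }
destruct He as [l Hl].
assert (Hs : is_series b l) by exact Hl.
split; [exists l; exact Hs|].
rewrite (is_series_unique _ _ Hs).
exact (is_lim_seq_le _ _ _ _ HB Hl (is_lim_seq_const B)).
Qed.

(* The square [n, m <= N] contains the first [N] rows entirely. *)
Lemma is_series_triangle (x : nat -> nat -> C) (y : nat -> R) :
  (forall n m, (n < m)%nat -> x n m = 0%C) ->
  (forall n, sum_n (fun m => Cmod (x n m)) n <= y n) -> ex_series y ->
  exists c : nat -> C,
    (forall m, is_series (fun n => x n m) (c m)) /\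
    (forall N, sum_n (fun m => Cmod (c m)) N <= Series y) /\
    (forall l : C, is_series (fun n => sum_n (x n) n) l -> is_series c l).
Proof.
intros H0 Hy Hey.
assert (Hpos : forall n k, 0 <= Cmod (x n k)) by (intros; apply Cmod_ge_0).
(* Entries beyond the diagonal vanish, so no partial row exceeds the bound on the full row. *)
assert (Hyn : forall N n, sum_n (fun m => Cmod (x n m)) N <= y n).
{ intros N n; apply Rle_trans with (2 := Hy n).
  destruct (Nat.le_gt_cases N n) as [Hn|Hn].
  - apply sum_n_R_mono; [apply Hpos|exact Hn].
  - induction N as [|N IH]; [lia|].
    rewrite sum_n_R_S, (H0 n (S N)) by lia; rewrite Cmod_0.
    destruct (Nat.eq_dec n N) as [->|Hne]; [lra|].
    assert (IH1 := IH ltac:(lia)); lra. }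
assert (Hxy : forall n m, Cmod (x n m) <= y n).
{ intros n m; apply Rle_trans with (2 := Hyn m n).
  apply (term_le_sum_n (fun m => Cmod (x n m))), Hpos. }
assert (Hc : forall m, {l : C | is_series (fun n => x n m) l}).
{ intros m; apply constructive_indefinite_description.
  apply (ex_series_C_abs _ y); [intros n; apply Hxy|exact Hey]. }
assert (Hc' : exists c : nat -> C, forall m, is_series (fun n => x n m) (c m)).
{ exists (fun m => proj1_sig (Hc m)); intros m; exact (proj2_sig (Hc m)). }
destruct Hc' as [c Hcs]; exists c.
split; [exact Hcs|].
assert (Hd : forall m, ex_series (fun n => Cmod (x n m))).
{ intros m; apply (ex_series_R_le _ y); [|exact Hey].
  intros n; split; [apply Hpos|apply Hxy]. }
split.
- intros N.
  apply Rle_trans with (Series (fun n => sum_n (fun m => Cmod (x n m)) N)).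
  + assert (HN : is_series (fun n => sum_n (fun m => Cmod (x n m)) N)
                   (sum_n (fun m => Series (fun n => Cmod (x n m))) N)).
    { induction N as [|N IH].
      - rewrite sum_O. apply is_series_ext with (fun n => Cmod (x n 0%nat)).
        + intros n; rewrite sum_O; reflexivity.
        + apply Series_correct, Hd.
      - rewrite sum_n_R_S.
        apply is_series_ext with
          (fun n => sum_n (fun m => Cmod (x n m)) N + Cmod (x n (S N))).
        + intros n; rewrite sum_n_R_S; reflexivity.
        + apply (is_series_plus (V := R_NormedModule) _ _ _ _ IH), Series_correct, Hd. }
    rewrite (is_series_unique _ _ HN).
    apply sum_n_m_le; intros m.
    apply (is_series_Cmod_le (fun n => x n m) (fun n => Cmod (x n m))).
    * intros n; lra.
    * apply Hcs.
    * apply Series_correct, Hd.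
  + apply Series_le; [|exact Hey].
    intros n; split; [|apply Hyn].
    apply Rle_trans with (1 := Hpos n N).
    apply (term_le_sum_n (fun m => Cmod (x n m))), Hpos.
- intros l Hl.
  assert (HN : forall N, is_series (fun n => sum_n (x n) N) (sum_n c N)).
  { induction N as [|N IH].
    - rewrite sum_O; apply is_series_ext with (fun n => x n 0%nat).
      + intros n; rewrite sum_O; reflexivity.
      + apply Hcs.
    - rewrite sum_n_C_S.
      apply is_series_ext with (fun n => sum_n (x n) N + x n (S N))%C.
      + intros n; rewrite sum_n_C_S; reflexivity.
      + exact (is_series_plus _ _ _ _ IH (Hcs (S N))). }
  apply is_series_C_eps; intros e He.
  destruct (proj1 (is_series_C_eps _ _) Hl (e / 2)) as [N1 H1]; [lra|].
  destruct (proj1 (is_series_R_eps _ _) (Series_correct _ Hey) (e / 2)) as [N2 H2]; [lra|].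
  exists (N1 + N2)%nat; intros N HNN.
  specialize (H1 N ltac:(lia)); specialize (H2 N ltac:(lia)).
  (* With columns cut at [N], the rows beyond [N] contribute at most the tail of [Series y]. *)
  assert (H3 := is_series_tail (fun n => sum_n (x n) N) y _ _ N
    (fun n => Rle_trans _ _ _ (Cmod_sum_n (x n) (fun m => Cmod (x n m)) N
       (fun k _ => Rle_refl _)) (Hyn N n)) (HN N) (Series_correct _ Hey)).
  assert (E : sum_n (fun n => sum_n (x n) N) N = sum_n (fun n => sum_n (x n) n) N).
  { apply sum_n_ext_loc; intros n Hn.
    clear -Hn H0; induction Hn as [|p Hp IH]; [reflexivity|].
    rewrite sum_n_C_S, IH, (H0 n (S p)) by lia; apply Cplus_0_r. }
  rewrite E in H3.
  replace (sum_n c N - l)%C with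
    ((sum_n c N - sum_n (fun n => sum_n (x n) n) N) +
     (sum_n (fun n => sum_n (x n) n) N - l))%C by ring.
  apply Rle_lt_trans with (1 := Cmod_triangle _ _).
  apply Rabs_def2 in H2; lra.
Qed.

(** * Binomial coefficients and the binomial theorem *)

Fixpoint binom (n m : nat) : R :=
  match n, m with
  | _, O => 1
  | O, S _ => 0
  | S n', S m' => binom n' m' + binom n' (S m')
  end.

Lemma binom_ge_0 (n m : nat) : 0 <= binom n m.
Proof.
revert m; induction n as [|n IH]; intros [|m]; simpl; try lra.
generalize (IH m) (IH (S m)); lra.
Qed.

Lemma binom_0 (n m : nat) : (n < m)%nat -> binom n m = 0.
Proof.
revert m; induction n as [|n IH]; intros [|m] H; simpl; try lia; try lra.
rewrite !IH by lia; lra.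
Qed.

Lemma binom_n_0 (n : nat) : binom n 0 = 1.
Proof. destruct n; reflexivity. Qed.

Lemma binom_n_1 (n : nat) : binom n 1 = INR n.
Proof.
induction n as [|n IH]; [reflexivity|].
rewrite S_INR, <- IH; simpl; rewrite binom_n_0; ring.
Qed.

Lemma sum_n_C_shift (u : nat -> C) (N : nat) :
  (sum_n u (S N) = u 0%nat + sum_n (fun k => u (S k)) N)%C.
Proof.
induction N as [|N IH].
- rewrite sum_n_C_S, !sum_O; reflexivity.
- rewrite sum_n_C_S, IH, sum_n_C_S; cring.
Qed.

Lemma sum_n_C_scal (c : C) (u : nat -> C) (N : nat) :
  sum_n (fun k => c * u k)%C N = (c * sum_n u N)%C.
Proof. exact (sum_n_mult_l (K := C_Ring) c u N). Qed.

Lemma sum_n_C_plus (u v : nat -> C) (N : nat) :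
  sum_n (fun k => u k + v k)%C N = (sum_n u N + sum_n v N)%C.
Proof. exact (sum_n_plus u v N). Qed.

(* Truncated subtraction in the exponent is harmless, as [binom n m = 0] for [n < m]. *)
Definition binom_term (x y : C) (n m : nat) : C := (binom n m * x ^ (n - m) * y ^ m)%C.

(** Induction by Pascal's rule. The range [N] is left free above [n], so that the induction
    hypothesis serves both for the sum up to [N] and for the one up to [S N] from which the index 0
    has been split off. *)
Lemma Cpow_binomial (x y : C) (n N : nat) :
  (n <= N)%nat -> sum_n (binom_term x y n) N = ((x + y) ^ n)%C.
Proof.
revert N; induction n as [|n IH]; intros N HN.
- clear HN; induction N as [|N IHN].
  + rewrite sum_O; unfold binom_term; simpl; cring.
  + rewrite sum_n_C_S, IHN; unfold binom_term; simpl; cring.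
- destruct N as [|N]; [lia|].
  rewrite sum_n_C_shift.
  assert (E : forall k, binom_term x y (S n) (S k) =
                (y * binom_term x y n k + x * binom_term x y n (S k))%C).
  { intros k; unfold binom_term; simpl binom; simpl Nat.sub.
    rewrite RtoC_plus, Cpow_S.
    destruct (Nat.le_gt_cases (S k) n) as [Hk|Hk].
    - replace (n - k)%nat with (S (n - S k)) by lia; rewrite Cpow_S; ring.
    - rewrite (binom_0 n (S k)) by lia; ring. }
  rewrite (sum_n_ext _ _ N E), sum_n_C_plus, !sum_n_C_scal, (IH N) by lia.
  assert (E2 : (binom_term x y n 0 + sum_n (fun k => binom_term x y n (S k)) N = (x + y) ^ n)%C).
  { rewrite <- sum_n_C_shift; apply IH; lia. }
  rewrite Cpow_S, <- E2, E2 at 1.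
  replace (binom_term x y (S n) 0) with (x * binom_term x y n 0)%C.
  + rewrite <- E2; cring.
  + unfold binom_term; rewrite !binom_n_0, !Nat.sub_0_r; simpl; ring.
Qed.

Lemma sum_n_RtoC (u : nat -> R) (N : nat) :
  sum_n (fun k => RtoC (u k)) N = RtoC (sum_n u N).
Proof.
induction N as [|N IH]; [rewrite !sum_O; reflexivity|].
rewrite sum_n_C_S, sum_n_R_S, IH, RtoC_plus; reflexivity.
Qed.

Lemma pow_binomial (x y : R) (n N : nat) :
  (n <= N)%nat -> sum_n (fun m => binom n m * x ^ (n - m) * y ^ m) N = (x + y) ^ n.
Proof.
intros H; apply RtoC_inj.
rewrite <- sum_n_RtoC, RtoC_pow, RtoC_plus, <- (Cpow_binomial x y n N H).
apply sum_n_ext; intros m; unfold binom_term.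
rewrite !RtoC_mult, !RtoC_pow; reflexivity.
Qed.

(** Expand [(z1 + v) ^ n] binomially and exchange the two summations. The exchange is legitimate
    because row [n] is dominated by [Cmod (a n) * (Cmod z1 + w) ^ n], hence by the term at radius
    [r]. *)
Lemma recenter (a : nat -> C) (z1 : C) (w r : R) :
  0 < w -> Cmod z1 + w <= r -> abs_summable a r ->
  exists b : nat -> C,
    (forall m, is_series (fun n => a n * (binom n m * z1 ^ (n - m)))%C (b m)) /\
    abs_summable b w /\
    Series (fun m => Cmod (b m) * w ^ m) <= Series (fun n => Cmod (a n) * r ^ n) /\
    forall v l : C, Cmod v <= w -> is_pseries a (z1 + v)%C l -> is_pseries b v l.
Proof.
intros Hw Hr Ha.
set (y := fun n => Cmod (a n) * r ^ n).
assert (H1 : forall v : C, Cmod v <= w ->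
  forall n, sum_n (fun m => Cmod (a n * binom_term z1 v n m)%C) n <= y n).
{ intros v Hv n.
  rewrite (sum_n_ext _ (fun m => Cmod (a n) * (binom n m * Cmod z1 ^ (n - m) * Cmod v ^ m))).
  - rewrite (sum_n_mult_l (K := R_Ring) (Cmod (a n))).
    change (Cmod (a n) * sum_n (fun m => binom n m * Cmod z1 ^ (n - m) * Cmod v ^ m) n <= y n).
    rewrite pow_binomial by lia.
    apply Rmult_le_compat_l; [apply Cmod_ge_0|].
    apply pow_incr; split; [|lra].
    generalize (Cmod_ge_0 z1) (Cmod_ge_0 v); lra.
  - intros m; unfold binom_term; rewrite !Cmod_mult, !Cmod_pow, Cmod_R, Rabs_pos_eq;
      [reflexivity|apply binom_ge_0]. }
assert (H0 : forall (v : C) n m, (n < m)%nat -> (a n * binom_term z1 v n m)%C = 0%C).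
{ intros v n m H; unfold binom_term; rewrite (binom_0 n m H); ring. }
assert (Hw' : Cmod w <= w) by (rewrite Cmod_R, Rabs_pos_eq; lra).
destruct (is_series_triangle (fun n m => a n * binom_term z1 w n m)%C y (H0 w) (H1 w Hw') Ha)
  as [c [Hc [Hcs _]]].
assert (Hwm : forall m, (RtoC w ^ m)%C <> 0%C).
{ intros m; apply Cpow_nz; intros E; apply RtoC_inj in E; lra. }
(* The double sum is taken at [v = w], where column [m] sums to [w ^ m] times the wanted
   coefficient. *)
exists (fun m => / w ^ m * c m)%C.
assert (Hb : forall m, is_series (fun n => a n * (binom n m * z1 ^ (n - m)))%C (/ w ^ m * c m)%C).
{ intros m; apply is_series_ext with (fun n => (/ w ^ m) * (a n * binom_term z1 w n m))%C.
  - intros n; unfold binom_term.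
    match goal with |- @eq _ ?a ?b => change (@eq C a b) end; field; apply Hwm.
  - exact (is_series_scal (K := C_AbsRing) (V := C_NormedModule) (/ w ^ m)%C _ _ (Hc m)). }
split; [exact Hb|].
destruct (ex_series_bounded (fun m => Cmod (/ w ^ m * c m)%C * w ^ m) (Series y)) as [He Hs].
{ intros k; apply Rmult_le_pos; [apply Cmod_ge_0|apply pow_le; lra]. }
{ intros N; rewrite (sum_n_ext _ (fun m => Cmod (c m))); [apply Hcs|].
  intros m; rewrite Cmod_mult, Cmod_inv, Cmod_pow, Cmod_R, Rabs_pos_eq by (try apply Hwm; lra).
  match goal with |- @eq _ ?a ?b => change (@eq R a b) end; field; apply pow_nonzero; lra. }
split; [exact He|]; split; [exact Hs|].
intros v l Hv Hl; apply is_pseries_C in Hl; apply is_pseries_C.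
destruct (is_series_triangle (fun n m => a n * binom_term z1 v n m)%C y (H0 v) (H1 v Hv) Ha)
  as [d [Hd [_ Hdl]]].
(* At any other [v] the column sums [d m] must be [v ^ m] times the coefficients found at [w]. *)
apply is_series_ext with d.
- intros m; apply (is_series_C_unique (fun n => a n * binom_term z1 v n m)%C); [apply Hd|].
  apply is_series_ext with (fun n => v ^ m * (a n * (binom n m * z1 ^ (n - m))))%C.
  + intros n; unfold binom_term; cring.
  + rewrite (Cmult_comm _ (v ^ m)).
    exact (is_series_scal (K := C_AbsRing) (V := C_NormedModule) (v ^ m)%C _ _ (Hb m)).
- apply Hdl; apply is_series_ext with (2 := Hl).
  intros n; rewrite sum_n_C_scal, Cpow_binomial; [reflexivity|lia].
Qed.

(** * Uniqueness of coefficients and complex derivatives *)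

Lemma abs_summable_shift (d : nat -> C) (r : R) :
  0 < r -> abs_summable d r -> abs_summable (fun n => d (S n)) r.
Proof.
intros Hr H; apply (ex_series_incr_1 (K := R_AbsRing) (V := R_NormedModule)) in H.
apply (ex_series_scal (K := R_AbsRing) (V := R_NormedModule) (/ r)) in H.
apply ex_series_ext with (2 := H); intros n.
change (/ r * (Cmod (d (S n)) * (r * r ^ n)) = Cmod (d (S n)) * r ^ n).
field; lra.
Qed.

Lemma is_pseries_shift (d : nat -> C) (v l : C) :
  v <> 0%C -> is_pseries d v l -> is_pseries (fun n => d (S n)) v ((l - d 0%nat) / v)%C.
Proof.
intros Hv H; apply is_pseries_C in H; apply is_pseries_C.
assert (H1 : is_series (fun n => d (S n) * v ^ S n)%C (l - d 0%nat)%C).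
{ apply (is_series_incr_1 (fun n => d n * v ^ n)%C).
  refine (eq_ind l (is_series (fun n => d n * v ^ n)%C) H _ _).
  change (l = (l - d 0%nat) + d 0%nat * 1)%C; ring. }
apply (is_series_scal (K := C_AbsRing) (V := C_NormedModule) (/ v)%C) in H1.
unfold Cdiv; rewrite Cmult_comm.
apply is_series_ext with (2 := H1); intros n.
change (/ v * (d (S n) * (v * v ^ n)) = d (S n) * v ^ n)%C; field; exact Hv.
Qed.

(** After division by [v], what follows the constant term is the shifted series, bounded on the disc
    of radius [r]. This is continuity at 0 with an explicit linear rate. *)
Lemma is_pseries_head (d : nat -> C) (r : R) (v l : C) :
  0 < r -> abs_summable d r -> Cmod v <= r -> is_pseries d v l ->
  Cmod (l - d 0%nat)%C <= Cmod v * Series (fun n => Cmod (d (S n)) * r ^ n).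
Proof.
intros Hr Hd Hv H.
destruct (Req_dec (Cmod v) 0) as [E|E].
- apply Cmod_eq_0 in E; subst v.
  rewrite (is_pseries_at_0 d l H).
  replace (d 0%nat - d 0%nat)%C with (RtoC 0) by ring.
  rewrite Cmod_0; lra.
- assert (Hv0 : v <> 0%C) by (intros ->; apply E, Cmod_0).
  assert (H1 := is_pseries_shift d v l Hv0 H).
  assert (H2 := CPSeries_le _ r v (abs_summable_shift d r Hr Hd) Hv).
  rewrite (CPSeries_unique _ _ _ H1), Cmod_div in H2 by exact Hv0.
  assert (Hpos : 0 < Cmod v) by (generalize (Cmod_ge_0 v); lra).
  apply (Rmult_le_compat_l (Cmod v)) in H2; [|lra].
  replace (Cmod v * (Cmod (l - d 0%nat)%C / Cmod v)) with (Cmod (l - d 0%nat)%C) in H2;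
    [exact H2|field; exact E].
Qed.

(** By [is_pseries_head], [Cmod (d 0)] is at most a constant times any small [t]. The hypothesis
    leaves out the point 0 because shifted series arise by division by [v], so that [pseries_zero]
    can iterate the argument. *)
Lemma pseries_zero_0 (d : nat -> C) (r : R) :
  0 < r -> (forall v : C, v <> 0%C -> Cmod v < r -> is_pseries d v (RtoC 0)) ->
  d 0%nat = 0%C.
Proof.
intros Hr H.
assert (Ha : abs_summable d (r / 4)).
{ apply (abs_summable_of_disc d (fun _ => RtoC 0) r); [lra|intros; apply H; assumption]. }
set (K := Series (fun n => Cmod (d (S n)) * (r / 4) ^ n)).
assert (HK : forall t, 0 < t <= r / 4 -> Cmod (d 0%nat) <= t * K).
{ intros t Ht.
  generalize (is_pseries_head d (r / 4) t 0 ltac:(lra) Ha).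
  rewrite Cmod_R_pos by lra; intros H1.
  replace (Cmod (d 0%nat)) with (Cmod (0 - d 0%nat)%C).
  - apply H1; [lra|].
    apply H; [apply RtoC_neq_0; lra|rewrite Cmod_R_pos; lra].
  - rewrite <- Cmod_opp; f_equal; ring. }
apply Cmod_eq_0, Rle_antisym; [|apply Cmod_ge_0].
apply le_epsilon; intros e He.
(* [t] stays in the disc and makes [t * (Rabs K + 1)] at most [e]; the added 1 keeps the divisor
   positive. *)
set (t := Rmin (r / 4) (e / (Rabs K + 1))).
assert (HK1 : 0 < Rabs K + 1) by (generalize (Rabs_pos K); lra).
assert (Ht : 0 < t) by (apply Rmin_glb_lt; [lra|apply Rdiv_lt_0_compat; lra]).
apply Rle_trans with (t * K); [apply HK; split; [lra|apply Rmin_l]|].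
apply Rle_trans with (t * (Rabs K + 1)).
+ apply Rmult_le_compat_l; [lra|]; generalize (Rle_abs K); lra.
+ apply Rle_trans with (e / (Rabs K + 1) * (Rabs K + 1)).
  * apply Rmult_le_compat_r; [lra|apply Rmin_r].
  * right; field; lra.
Qed.

Lemma pseries_zero (d : nat -> C) (r : R) :
  0 < r -> (forall v : C, v <> 0%C -> Cmod v < r -> is_pseries d v (RtoC 0)) ->
  forall n, d n = 0%C.
Proof.
intros Hr H n; revert d H; induction n as [|n IH]; intros d H.
- exact (pseries_zero_0 d r Hr H).
- apply (IH (fun k => d (S k))); intros v Hv Hvr.
  assert (H1 := is_pseries_shift d v 0 Hv (H v Hv Hvr)).
  rewrite (pseries_zero_0 d r Hr H) in H1.
  replace ((0 - 0) / v)%C with (RtoC 0) in H1 by (field; exact Hv); exact H1.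
Qed.

Lemma pseries_coeff_unique (a b : nat -> C) (f : C -> C) (r : R) :
  0 < r -> (forall v : C, Cmod v < r -> is_pseries a v (f v)) ->
  (forall v : C, Cmod v < r -> is_pseries b v (f v)) -> forall n, a n = b n.
Proof.
intros Hr Ha Hb n; apply Ceq_minus.
apply (pseries_zero (fun n => a n - b n)%C r Hr).
intros v _ Hv; replace (RtoC 0) with (f v - f v)%C by ring.
apply is_pseries_C_minus; [apply Ha|apply Hb]; exact Hv.
Qed.

(** The difference quotient is the value of the once-shifted series, and [is_pseries_head] bounds
    its distance to the constant term [b 1] linearly in [Cmod v]. *)
Lemma is_derive_pseries (f : C -> C) (z0 : C) (b : nat -> C) (r : R) :
  0 < r -> (forall v : C, Cmod v < r -> is_pseries b v (f (z0 + v)%C)) ->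
  is_derive f z0 (b 1%nat).
Proof.
intros Hr H; split; [apply is_linear_scal_l|].
intros z Hz.
apply (is_filter_lim_locally_unique (V := AbsRing_NormedModule C_AbsRing)) in Hz; subst z.
intros eps; apply (locally_le_locally_norm (V := AbsRing_NormedModule C_AbsRing)).
set (s := r / 4).
assert (Ha : abs_summable b s).
{ apply (abs_summable_of_disc b (fun v => f (z0 + v)%C) r);
    [unfold s; lra|intros; apply H; assumption]. }
assert (Hs : 0 < s) by (unfold s; lra).
set (K := Series (fun n => Cmod (b (S (S n))) * s ^ n)).
assert (HK1 : 0 < Rabs K + 1) by (generalize (Rabs_pos K); lra).
assert (Hd : 0 < Rmin s (eps / (Rabs K + 1))).
{ apply Rmin_glb_lt; [lra|apply Rdiv_lt_0_compat; [apply cond_pos|lra]]. }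
exists (mkposreal _ Hd); intros y Hy.
change (Cmod (y - z0)%C < Rmin s (eps / (Rabs K + 1))) in Hy.
change (Cmod ((f y - f z0) - (y - z0) * b 1%nat)%C <= eps * Cmod (y - z0)%C).
set (v := (y - z0)%C) in *.
assert (Hvs : Cmod v <= s) by (left; apply Rlt_le_trans with (1 := Hy), Rmin_l).
assert (Hve : Cmod v <= eps / (Rabs K + 1)).
{ left; apply Rlt_le_trans with (1 := Hy), Rmin_r. }
assert (Hy0 : f z0 = b 0%nat).
{ assert (H0 := H 0%C ltac:(rewrite Cmod_0; lra)).
  rewrite Cplus_0_r in H0; exact (is_pseries_at_0 _ _ H0). }
destruct (Req_dec (Cmod v) 0) as [E|E].
- apply Cmod_eq_0 in E; rewrite E.
  rewrite (proj2 (Ceq_minus y z0) E).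
  replace (f z0 - f z0 - 0 * b 1%nat)%C with (RtoC 0) by ring.
  rewrite Cmod_0; lra.
- assert (Hv0 : v <> 0%C) by (intros E0; apply E; rewrite E0; apply Cmod_0).
  assert (H1 := H v ltac:(unfold s in Hvs; lra)).
  assert (Ey : forall p q : C, (q + (p - q))%C = p) by (intros; ring).
  rewrite (Ey y z0 : (z0 + v)%C = y) in H1.
  assert (H2 := is_pseries_shift b v _ Hv0 H1).
  assert (H3 := is_pseries_head (fun n => b (S n)) s v _ Hs (abs_summable_shift b s Hs Ha) Hvs H2).
  cbv beta in H3; fold K in H3.
  replace (f y - f z0 - v * b 1%nat)%C with (v * ((f y - b 0%nat) / v - b 1%nat))%C
    by (rewrite Hy0; field; exact Hv0).
  rewrite Cmod_mult, Rmult_comm; apply Rmult_le_compat_r; [apply Cmod_ge_0|].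
  apply Rle_trans with (1 := H3).
  apply Rle_trans with (Cmod v * (Rabs K + 1)).
  + apply Rmult_le_compat_l; [apply Cmod_ge_0|]; generalize (Rle_abs K); lra.
  + apply Rle_trans with (eps / (Rabs K + 1) * (Rabs K + 1)).
    * apply Rmult_le_compat_r; [lra|exact Hve].
    * right; field; lra.
Qed.

(** * Expansions in the unit disc and their derivatives *)

Definition disc_expansion (a : nat -> C) (f : C -> C) : Prop :=
  forall z : C, unit_disc z -> is_pseries a z (f z).

Lemma disc_expansion_abs_summable (a : nat -> C) (f : C -> C) (r : R) :
  disc_expansion a f -> 0 <= r < 1 -> abs_summable a r.
Proof.
intros H Hr; apply (abs_summable_of_disc a f 1); [exact Hr|intros v Hv _; apply H, Hv].
Qed.

Lemma disc_expansion_recenter (a : nat -> C) (f : C -> C) (z0 : C) :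
  disc_expansion a f -> unit_disc z0 ->
  exists (b : nat -> C) (w : R), 0 < w /\
    (forall m, is_series (fun n => a n * (binom n m * z0 ^ (n - m)))%C (b m)) /\
    (forall v : C, Cmod v <= w -> is_pseries b v (f (z0 + v)%C)).
Proof.
unfold unit_disc; intros H Hz.
set (r := (1 + Cmod z0) / 2).
assert (H0 := Cmod_ge_0 z0).
destruct (recenter a z0 (r - Cmod z0) r) as [b [Hb [_ [_ Hl]]]].
- unfold r; lra.
- lra.
- apply (disc_expansion_abs_summable a f r H); unfold r; lra.
- exists b, (r - Cmod z0); split; [unfold r; lra|]; split; [exact Hb|].
  intros v Hv; apply Hl; [exact Hv|]; apply H; unfold unit_disc.
  apply Rle_lt_trans with (1 := Cmod_triangle _ _); unfold r in *; lra.
Qed.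

Lemma disc_expansion_analytic (a : nat -> C) (f : C -> C) :
  disc_expansion a f -> analytic_in_disc f.
Proof.
intros H z0 Hz0; destruct (disc_expansion_recenter a f z0 H Hz0) as [b [w [Hw [_ Hb]]]].
exists b, w; split; [exact Hw|]; intros z Hz.
replace (f z) with (f (z0 + (z - z0))%C) by (f_equal; ring).
apply Hb; lra.
Qed.

Definition dcoef (a : nat -> C) (n : nat) : C := (RtoC (INR (S n)) * a (S n))%C.

(** The derivative is the linear coefficient of the re-expansion at [z0], the sum of
    [n * a n * z0 ^ (n - 1)] since [binom n 1] is [n]. Its term of index 0 vanishes; dropping it
    leaves the series of [dcoef a]. *)
Lemma disc_expansion_derive (a : nat -> C) (f : C -> C) (z0 : C) :
  disc_expansion a f -> unit_disc z0 ->
  exists l, is_derive f z0 l /\ is_pseries (dcoef a) z0 l.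
Proof.
intros H Hz0; destruct (disc_expansion_recenter a f z0 H Hz0) as [b [w [Hw [Hb Hf]]]].
exists (b 1%nat); split.
- apply (is_derive_pseries f z0 b w Hw); intros v Hv; apply Hf; lra.
- apply is_pseries_C.
  apply is_series_ext with (fun n => a (S n) * (binom (S n) 1 * z0 ^ (S n - 1)))%C.
  + intros n; unfold dcoef; rewrite binom_n_1, Nat.sub_succ, Nat.sub_0_r; cring.
  + apply (is_series_incr_1 (fun n => a n * (binom n 1 * z0 ^ (n - 1)))%C).
    refine (eq_ind _ (is_series (fun n => a n * (binom n 1 * z0 ^ (n - 1)))%C) (Hb 1%nat) _ _).
    change (b 1%nat = b 1%nat + a 0%nat * (0 * 1))%C; ring.
Qed.

Lemma disc_expansion_C_derive (a : nat -> C) (f : C -> C) :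
  disc_expansion a f -> disc_expansion (dcoef a) (C_derive f).
Proof.
intros H z0 Hz0; destruct (disc_expansion_derive a f z0 H Hz0) as [l [Hl Hs]].
rewrite (is_C_derive_unique f z0 l Hl); exact Hs.
Qed.

(** * Trigonometric series and roots of unity *)

Lemma Cpow_cis (x : R) (n : nat) :
  Cpow (cos x, sin x) n = (cos (INR n * x), sin (INR n * x)).
Proof.
induction n as [|n IH].
- simpl; rewrite Rmult_0_l, cos_0, sin_0; reflexivity.
- rewrite Cpow_S, IH, S_INR, Rmult_plus_distr_r, Rmult_1_l, cos_plus, sin_plus.
  unfold Cmult; simpl; f_equal; ring.
Qed.

(** The order is [S K], so that a [sum_n] up to [K] runs exactly once through the powers of [w]. *)
Definition primitive (w : C) (K : nat) : Prop :=
  Cmod w = 1 /\ (w ^ S K = 1)%C /\ forall m, (0 < m <= K)%nat -> (w ^ m <> 1)%C.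

Lemma primitive_root_exists (N : nat) :
  exists w : C, primitive w N.
Proof.
set (x := 2 * PI / INR (S N)).
assert (HN : 0 < INR (S N)) by (apply lt_0_INR; lia).
exists (cos x, sin x); split; [|split].
- unfold Cmod; simpl.
  replace (cos x * (cos x * 1) + sin x * (sin x * 1)) with 1; [apply sqrt_1|].
  generalize (sin2_cos2 x); unfold Rsqr; lra.
- rewrite Cpow_cis.
  replace (INR (S N) * x) with (2 * PI) by (unfold x; field; lra).
  rewrite cos_2PI, sin_2PI; reflexivity.
- intros m Hm E; rewrite Cpow_cis in E; apply (f_equal fst) in E; simpl in E.
  assert (Hm0 : 0 < INR m) by (apply lt_0_INR; lia).
  assert (HmN : INR m < INR (S N)) by (apply lt_INR; lia).
  assert (Hpi := PI_RGT_0).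
  (* [w ^ m = 1] would give [cos (2 * y) = 1], hence [sin y = 0], although [0 < y < PI]. *)
  set (y := INR m * x / 2).
  replace (INR m * x) with (2 * y) in E by (unfold y; field).
  rewrite cos_2a_sin in E.
  assert (Hy : 0 < y < PI).
  { unfold y, x; split.
    - apply Rdiv_lt_0_compat; [|lra].
      apply Rmult_lt_0_compat; [lra|apply Rdiv_lt_0_compat; lra].
    - replace (INR m * (2 * PI / INR (S N)) / 2) with (INR m / INR (S N) * PI)
        by (field; lra).
      rewrite <- (Rmult_1_l PI) at 2; apply Rmult_lt_compat_r; [lra|].
      apply (Rdiv_lt_1 (INR m)); lra. }
  assert (Hs := sin_gt_0 y (proj1 Hy) (proj2 Hy)); nra.
Qed.

(** * Averages over roots of unity, in place of integrals over the circle *)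

Definition avg (w : C) (K : nat) (g : C -> C) : C :=
  (/ RtoC (INR (S K)) * sum_n (fun j => g (w ^ j)) K)%C.

Lemma avg_ext (w : C) (K : nat) (g h : C -> C) :
  Cmod w = 1 -> (forall z : C, Cmod z = 1 -> g z = h z) -> avg w K g = avg w K h.
Proof.
intros Hw H; unfold avg; f_equal; apply sum_n_ext; intros j; apply H.
rewrite Cmod_pow, Hw, pow1; reflexivity.
Qed.

Lemma avg_plus (w : C) (K : nat) (g h : C -> C) :
  avg w K (fun z => g z + h z)%C = (avg w K g + avg w K h)%C.
Proof. unfold avg; rewrite sum_n_C_plus; ring. Qed.

Lemma avg_scal (w : C) (K : nat) (c : C) (g : C -> C) :
  avg w K (fun z => c * g z)%C = (c * avg w K g)%C.
Proof. unfold avg; rewrite sum_n_C_scal; ring. Qed.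

Lemma avg_sum_n (w : C) (K D : nat) (g : nat -> C -> C) :
  avg w K (fun z => sum_n (fun m => g m z) D) = sum_n (fun m => avg w K (g m)) D.
Proof.
induction D as [|D IH].
- rewrite sum_O; unfold avg; f_equal; apply sum_n_ext; intros j; rewrite sum_O; reflexivity.
- rewrite sum_n_C_S, <- IH, <- avg_plus; unfold avg; f_equal.
  apply sum_n_ext; intros j; rewrite sum_n_C_S; reflexivity.
Qed.

Lemma INR_S_neq_0 (K : nat) : RtoC (INR (S K)) <> 0%C.
Proof. apply RtoC_neq_0, not_0_INR; lia. Qed.

Lemma avg_const (w : C) (K : nat) (c : C) : avg w K (fun _ => c) = c.
Proof.
unfold avg.
replace (sum_n (fun _ => c) K) with (RtoC (INR (S K)) * c)%C.
- field; apply INR_S_neq_0.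
- induction K as [|K IH].
  + rewrite sum_O; simpl; cring.
  + rewrite sum_n_C_S, <- IH, (S_INR (S K)), RtoC_plus; cring.
Qed.

Lemma geometric_zero (q : C) (K : nat) :
  (q <> 1)%C -> (q ^ S K = 1)%C -> sum_n (fun j => q ^ j)%C K = RtoC 0.
Proof.
intros Hq HK.
assert (E : ((q - 1) * sum_n (fun j => q ^ j)%C K = q ^ S K - 1)%C).
{ clear; induction K as [|K IH].
  - rewrite sum_O; simpl; ring.
  - rewrite sum_n_C_S, Cmult_plus_distr_l, IH, !Cpow_S; ring. }
assert (Hq1 : (q - 1)%C <> 0%C) by (intros E0; apply Hq, Ceq_minus, E0).
replace (sum_n (fun j => q ^ j)%C K) with (/ (q - 1) * ((q - 1) * sum_n (fun j => q ^ j)%C K))%C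
  by (field; exact Hq1).
rewrite E, HK; cring.
Qed.

Lemma Cconj_mult_unit (z : C) : Cmod z = 1 -> (z * Cconj z = 1)%C.
Proof. intros H; rewrite <- Cmod2_conj, H; f_equal; ring. Qed.

(** Orthogonality of characters: the average is a geometric sum whose ratio [q] is a root of unity.
    Since both exponents are at most [K], primitivity forces [q <> 1] as soon as [m] and [n]
    differ. *)
Lemma avg_mult_conj (w : C) (K m n : nat) :
  primitive w K -> (m <= K)%nat -> (n <= K)%nat ->
  avg w K (fun z => z ^ m * Cconj z ^ n)%C = if Nat.eq_dec m n then RtoC 1 else RtoC 0.
Proof.
intros [Hw [HwK Hp]] Hm Hn.
set (q := (w ^ m * Cconj w ^ n)%C).
assert (Hu := Cconj_mult_unit w Hw).
assert (E : avg w K (fun z => z ^ m * Cconj z ^ n)%C =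
            (/ RtoC (INR (S K)) * sum_n (fun j => q ^ j) K)%C).
{ unfold avg; f_equal; apply sum_n_ext; intros j; unfold q.
  rewrite Cpow_mult_l, Cpow_conj, <- !Cpow_mult_r, (Nat.mul_comm j m), (Nat.mul_comm j n).
  reflexivity. }
assert (Hun : forall k, (w ^ k * Cconj w ^ k = 1)%C).
{ intros k; rewrite <- Cpow_mult_l, Hu; apply Cpow_1_l. }
destruct (Nat.eq_dec m n) as [->|Hmn].
- transitivity (avg w K (fun _ => 1%C)); [|apply avg_const].
  apply avg_ext; [exact Hw|]; intros z Hz.
  rewrite <- Cpow_mult_l, Cconj_mult_unit by exact Hz; apply Cpow_1_l.
- rewrite E, geometric_zero; [ring| |].
  + intros E1.
    assert (E2 : (w ^ m = w ^ n)%C).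
    { replace (w ^ m)%C with (q * w ^ n)%C; [rewrite E1; ring|].
      unfold q; rewrite <- Cmult_assoc, (Cmult_comm (Cconj w ^ n)), Hun; ring. }
    destruct (Nat.lt_total m n) as [H|[H|H]]; [| contradiction |].
    * apply (Hp (n - m)%nat); [lia|].
      replace (w ^ (n - m))%C with (w ^ (n - m) * (w ^ m * Cconj w ^ m))%C
        by (rewrite Hun; ring).
      rewrite Cmult_assoc, <- Cpow_add_r.
      replace (n - m + m)%nat with n by lia; rewrite <- E2; apply Hun.
    * apply (Hp (m - n)%nat); [lia|].
      replace (w ^ (m - n))%C with (w ^ (m - n) * (w ^ n * Cconj w ^ n))%C
        by (rewrite Hun; ring).
      rewrite Cmult_assoc, <- Cpow_add_r.
      replace (m - n + n)%nat with m by lia; rewrite E2; apply Hun.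
  + unfold q; rewrite Cpow_mult_l, <- !Cpow_mult_r, (Nat.mul_comm m), (Nat.mul_comm n),
      !Cpow_mult_r, <- Cpow_conj, HwK, <- Cpow_conj.
    rewrite !Cpow_1_l.
    replace (Cconj 1) with (RtoC 1) by (unfold Cconj, RtoC; simpl; f_equal; ring); ring.
Qed.

Lemma avg_conj_conj (w : C) (K m n : nat) :
  primitive w K -> (m + n <= K)%nat ->
  avg w K (fun z => Cconj z ^ m * Cconj z ^ n)%C = if Nat.eq_dec (m + n) 0 then RtoC 1 else RtoC 0.
Proof.
intros Hp Hmn.
rewrite (avg_ext w K _ (fun z => z ^ 0 * Cconj z ^ (m + n))%C).
- rewrite avg_mult_conj by (try exact Hp; lia).
  destruct (Nat.eq_dec 0 (m + n)), (Nat.eq_dec (m + n) 0); (reflexivity || lia).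
- apply Hp.
- intros z _; rewrite Cpow_add_r; simpl; ring.
Qed.

Lemma sum_n_C_delta (u : nat -> C) (D n : nat) :
  (n <= D)%nat ->
  sum_n (fun m => u m * if Nat.eq_dec m n then 1 else 0)%C D = u n.
Proof.
assert (H0 : forall D, (D < n)%nat ->
  sum_n (fun m => u m * if Nat.eq_dec m n then 1 else 0)%C D = RtoC 0).
{ clear D; induction D as [|D IH]; intros H.
  - rewrite sum_O; destruct (Nat.eq_dec 0 n); [lia|cring].
  - rewrite sum_n_C_S, IH by lia; destruct (Nat.eq_dec (S D) n); [lia|cring]. }
induction 1 as [|D HD IH].
- destruct n as [|n].
  + rewrite sum_O; destruct (Nat.eq_dec 0 0); [cring|lia].
  + rewrite sum_n_C_S, H0 by lia; destruct (Nat.eq_dec (S n) (S n)); [cring|lia].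
- rewrite sum_n_C_S, IH; destruct (Nat.eq_dec (S D) n); [lia|cring].
Qed.

Lemma Cconj_sum_n (u : nat -> C) (D : nat) :
  Cconj (sum_n u D) = sum_n (fun m => Cconj (u m)) D.
Proof.
induction D as [|D IH]; [rewrite !sum_O; reflexivity|].
rewrite !sum_n_C_S, Cplus_conj, IH; reflexivity.
Qed.

(* Partial sums of the real trigonometric series with nonnegative-index
   coefficients [t n] and [t (-n) = Cconj (t n)]. *)
Definition trig (t : nat -> C) (D : nat) (z : C) : R :=
  2 * Re (sum_n (fun m => t m * z ^ m)%C D) - Re (t 0%nat).

(** With [2 * D + 1] nodes, frequencies differing by at most [2 * D] are not confused, so the
    average is the exact coefficient. For [n = 0] the reality of [t 0] matters, as [trig] sees only
    its real part. *)
Lemma avg_trig (w : C) (t : nat -> C) (D n : nat) :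
  primitive w (2 * D) -> (n <= D)%nat -> (n = 0%nat -> Im (t 0%nat) = 0) ->
  avg w (2 * D) (fun z => RtoC (trig t D z) * Cconj z ^ n)%C = t n.
Proof.
intros Hp Hn Ht.
(* Twice the real part is the sum plus its conjugate; the last summand corrects for the doubled
   constant term. *)
rewrite (avg_ext w _ _ (fun z =>
  (sum_n (fun m => t m * (z ^ m * Cconj z ^ n)) D +
   sum_n (fun m => Cconj (t m) * (Cconj z ^ m * Cconj z ^ n)) D) +
  (- RtoC (Re (t 0%nat))) * (z ^ 0 * Cconj z ^ n))%C).
- rewrite !avg_plus, !avg_sum_n, avg_scal, avg_mult_conj by (try exact Hp; lia).
  rewrite (sum_n_ext_loc _ (fun m => t m * if Nat.eq_dec m n then 1 else 0)%C D).
  2:{ intros m Hm; rewrite avg_scal, avg_mult_conj by (try exact Hp; lia); reflexivity. }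
  rewrite sum_n_C_delta by exact Hn.
  destruct (Nat.eq_dec 0 n) as [<-|Hn0].
  + rewrite (sum_n_ext_loc _ (fun m => Cconj (t m) * if Nat.eq_dec m 0 then 1 else 0)%C D).
    2:{ intros m Hm; rewrite avg_scal, avg_conj_conj by (try exact Hp; lia).
        rewrite Nat.add_0_r; reflexivity. }
    rewrite sum_n_C_delta by lia.
    specialize (Ht eq_refl); destruct (t 0%nat) as [x y]; simpl in Ht; subst y.
    unfold Cconj, Cplus, Cmult, Copp, RtoC, Re; simpl; f_equal; ring.
  + rewrite (sum_n_ext_loc _ (fun m => 0 * 1)%C D).
    2:{ intros m Hm; rewrite avg_scal, avg_conj_conj by (try exact Hp; lia).
        destruct (Nat.eq_dec (m + n) 0); [lia|cring]. }
    rewrite sum_n_C_scal; ring.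
- apply Hp.
- intros z Hz.
  assert (E : forall u : nat -> C, sum_n (fun m => u m * Cconj z ^ n)%C D =
            (Cconj z ^ n * sum_n u D)%C).
  { intros u; rewrite <- sum_n_C_scal; apply sum_n_ext; intros m; cring. }
  rewrite (sum_n_ext _ (fun m => (t m * z ^ m) * Cconj z ^ n)%C) by (intros; cring).
  rewrite (sum_n_ext (fun m => Cconj (t m) * (Cconj z ^ m * Cconj z ^ n))%C
             (fun m => Cconj (t m * z ^ m) * Cconj z ^ n)%C)
    by (intros; rewrite Cmult_conj, Cpow_conj; cring).
  rewrite !E, <- Cconj_sum_n; unfold trig.
  set (S := sum_n (fun m => t m * z ^ m)%C D); clearbody S.
  replace (RtoC (2 * Re S - Re (t 0%nat))) with (S + Cconj S - Re (t 0%nat))%C.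
  + simpl (z ^ 0)%C; ring.
  + destruct S as [x y]; unfold Cminus; unfold Cconj, Cplus, Copp, RtoC, Re; simpl; f_equal; ring.
Qed.

Lemma Cmod_avg_le (w : C) (K : nat) (g : C -> C) (B : R) :
  Cmod w = 1 -> (forall z : C, Cmod z = 1 -> Cmod (g z) <= B) -> Cmod (avg w K g) <= B.
Proof.
intros Hw H; unfold avg.
rewrite Cmod_mult, Cmod_inv, Cmod_R_pos by (apply INR_S_neq_0 || apply pos_INR).
assert (HK : 0 < INR (S K)) by (apply lt_0_INR; lia).
apply (Rmult_le_reg_l (INR (S K))); [exact HK|].
rewrite <- Rmult_assoc, Rinv_r, Rmult_1_l by lra.
rewrite <- sum_n_const; apply Cmod_sum_n; intros j _; apply H.
rewrite Cmod_pow, Hw, pow1; reflexivity.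
Qed.

Lemma Re_sum_n (u : nat -> C) (D : nat) : Re (sum_n u D) = sum_n (fun m => Re (u m)) D.
Proof.
induction D as [|D IH]; [rewrite !sum_O; reflexivity|].
rewrite sum_n_C_S, sum_n_R_S, re_plus, IH; reflexivity.
Qed.

Lemma Re_avg_ge_0 (w : C) (K : nat) (g : C -> C) :
  Cmod w = 1 -> (forall z : C, Cmod z = 1 -> 0 <= Re (g z)) -> 0 <= Re (avg w K g).
Proof.
intros Hw H; unfold avg.
rewrite <- RtoC_inv by (apply not_0_INR; lia).
rewrite re_scal_l, Re_sum_n.
apply Rmult_le_pos; [apply Rlt_le, Rinv_0_lt_compat, lt_0_INR; lia|].
assert (Hj : forall j, 0 <= Re (g (w ^ j)%C)).
{ intros j; apply H; rewrite Cmod_pow, Hw, pow1; reflexivity. }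
apply Rle_trans with (1 := Hj K), (term_le_sum_n (fun j => Re (g (w ^ j)%C))), Hj.
Qed.

(** * Uniform limits: absolutely summable trigonometric series *)

Lemma pseries_uniform (t : nat -> C) (e : R) :
  abs_summable t 1 -> 0 < e -> exists N, forall D, (N <= D)%nat -> forall z : C, Cmod z <= 1 ->
    Cmod (CPSeries t z - sum_n (fun m => t m * z ^ m)%C D)%C <= e.
Proof.
intros Ht He.
assert (Hs := Series_correct _ Ht).
destruct (proj1 (is_series_R_eps _ _) Hs e He) as [N HN].
exists N; intros D HD z Hz; specialize (HN D HD); apply Rabs_def2 in HN.
apply Rle_trans with (Series (fun n => Cmod (t n) * 1 ^ n) -
                      sum_n (fun n => Cmod (t n) * 1 ^ n) D); [|lra].
apply is_series_tail; [| |exact Hs].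
- intros k; rewrite Cmod_mult, Cmod_pow.
  apply Rmult_le_compat_l; [apply Cmod_ge_0|].
  apply pow_incr; split; [apply Cmod_ge_0|exact Hz].
- apply is_pseries_C, (CPSeries_correct t 1 z Ht Hz).
Qed.

Definition Trig (t : nat -> C) (z : C) : R := 2 * Re (CPSeries t z) - Re (t 0%nat).

Lemma trig_uniform (t : nat -> C) (e : R) :
  abs_summable t 1 -> 0 < e -> exists N, forall D, (N <= D)%nat -> forall z : C, Cmod z <= 1 ->
    Rabs (Trig t z - trig t D z) <= e.
Proof.
intros Ht He; destruct (pseries_uniform t (e / 2) Ht) as [N HN]; [lra|].
exists N; intros D HD z Hz; specialize (HN D HD z Hz).
unfold Trig, trig.
assert (H := re_le_Cmod (CPSeries t z - sum_n (fun m => t m * z ^ m)%C D)%C).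
unfold Cminus in H, HN; rewrite re_plus, re_opp in H.
match goal with |- Rabs ?x <= _ => replace x with
  (2 * (Re (CPSeries t z) + - Re (sum_n (fun m => t m * z ^ m)%C D))) by ring end.
rewrite Rabs_mult, (Rabs_pos_eq 2); lra.
Qed.

(** By [avg_trig] the coefficient is an average of [trig t D z * Cconj z ^ n], and for large [D] the
    partial sum is uniformly within [e] of [Trig t]. *)
Lemma trig_coeff_le (t : nat -> C) (B : R) (n : nat) :
  abs_summable t 1 -> (0 < n)%nat -> (forall z : C, Cmod z = 1 -> Rabs (Trig t z) <= B) ->
  Cmod (t n) <= B.
Proof.
intros Ht Hn HB; apply le_epsilon; intros e He.
destruct (trig_uniform t e Ht He) as [N HN].
set (D := (N + n)%nat).
destruct (primitive_root_exists (2 * D)) as [w Hw].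
rewrite <- (avg_trig w t D n Hw) by (unfold D; lia).
apply Cmod_avg_le; [apply Hw|]; intros z Hz.
rewrite Cmod_mult, Cmod_pow, Cmod_conj, Hz, pow1, Rmult_1_r, Cmod_R.
specialize (HN D ltac:(unfold D; lia) z ltac:(lra)); specialize (HB z Hz).
replace (trig t D z) with (Trig t z + - (Trig t z - trig t D z)) by ring.
apply Rle_trans with (1 := Rabs_triang _ _); rewrite Rabs_Ropp; lra.
Qed.

Lemma abs_summable_mult (t s : nat -> C) (r r' : R) :
  0 <= r -> 0 <= r' -> abs_summable t r -> abs_summable s r' ->
  abs_summable (fun n => t n * s n)%C (r * r').
Proof.
intros Hr Hr' Ht Hs.
assert (Hpos : forall k, 0 <= Cmod (t k) * r ^ k).
{ intros k; apply Rmult_le_pos; [apply Cmod_ge_0|apply pow_le, Hr]. }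
assert (Hpos' : forall k, 0 <= Cmod (s k) * r' ^ k).
{ intros k; apply Rmult_le_pos; [apply Cmod_ge_0|apply pow_le, Hr']. }
apply (ex_series_R_le _ (fun n => Series (fun k => Cmod (t k) * r ^ k) * (Cmod (s n) * r' ^ n))).
- intros n; rewrite Cmod_mult, Rpow_mult_distr.
  replace (Cmod (t n) * Cmod (s n) * (r ^ n * r' ^ n))
    with (Cmod (t n) * r ^ n * (Cmod (s n) * r' ^ n)) by ring.
  split; [apply Rmult_le_pos; auto|].
  apply Rmult_le_compat_r; [auto|].
  apply (term_le_Series (fun k => Cmod (t k) * r ^ k)); assumption.
- exact (ex_series_scal (K := R_AbsRing) (V := R_NormedModule) _ _ Hs).
Qed.

(** The average over [z] of the product of [trig t D z + e] and [trig s D (z0 * Cconj z) + e], both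
    nonnegative, is a discrete convolution at [z0]: it multiplies coefficients, and the shifts by
    [e] produce the remaining terms. *)
Lemma trig_mult_ge (t s : nat -> C) (D : nat) (e : R) (z0 : C) :
  Im (t 0%nat) = 0 -> Im (s 0%nat) = 0 -> Cmod z0 = 1 ->
  (forall z : C, Cmod z = 1 -> - e <= trig t D z) ->
  (forall z : C, Cmod z = 1 -> - e <= trig s D z) ->
  0 <= trig (fun n => t n * s n)%C D z0 + e * (Re (t 0%nat) + Re (s 0%nat)) + e * e.
Proof.
intros Ht Hs Hz0 HT HS.
destruct (primitive_root_exists (2 * D)) as [w Hw].
(* [G] is this product with the real part in [trig s] left off: its real part is the product, and
   each of its terms is an average already computed. *)
set (G := fun z : C => (sum_n (fun n => 2 * s n * z0 ^ n * (RtoC (trig t D z) * Cconj z ^ n)) D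
   + (RtoC e - s 0%nat) * (RtoC (trig t D z) * Cconj z ^ 0)
   + sum_n (fun n => 2 * e * s n * z0 ^ n * (z ^ 0 * Cconj z ^ n)) D
   + (e * e - e * s 0%nat) * 1)%C).
assert (HG : forall z : C, Cmod z = 1 -> 0 <= Re (G z)).
{ intros z Hz.
  assert (H1 := HT z Hz).
  assert (H2 := HS (z0 * Cconj z)%C ltac:(rewrite Cmod_mult, Cmod_conj, Hz, Hz0; ring)).
  replace (Re (G z)) with ((trig t D z + e) * (trig s D (z0 * Cconj z)%C + e)).
  { apply Rmult_le_pos; lra. }
  unfold G, trig at 2.
  set (S := sum_n (fun m => s m * (z0 * Cconj z) ^ m)%C D).
  set (T := trig t D z).
  rewrite (sum_n_ext _ (fun n => (2 * RtoC T) * (s n * (z0 * Cconj z) ^ n))%C)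
    by (intros n; rewrite Cpow_mult_l; cring).
  rewrite (sum_n_ext (fun n => 2 * e * s n * z0 ^ n * (z ^ 0 * Cconj z ^ n))%C
     (fun n => (2 * RtoC e) * (s n * (z0 * Cconj z) ^ n))%C)
    by (intros n; rewrite Cpow_mult_l; simpl; ring).
  rewrite !sum_n_C_scal; fold S.
  simpl (Cconj z ^ 0)%C.
  clearbody S T.
  destruct S as [sx sy]; destruct (s 0%nat) as [px py].
  unfold Cminus; unfold Cmult, Cplus, Copp, RtoC, Re; simpl; ring. }
assert (H := Re_avg_ge_0 w (2 * D) G (proj1 Hw) HG).
replace (trig (fun n => t n * s n)%C D z0 + e * (Re (t 0%nat) + Re (s 0%nat)) + e * e)
  with (Re (avg w (2 * D) G)); [exact H|].
unfold G; rewrite !avg_plus, !avg_sum_n, !avg_scal.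
rewrite (sum_n_ext_loc _ (fun n => 2 * (t n * s n * z0 ^ n))%C D).
2:{ intros n Hn; rewrite avg_scal, avg_trig; [cring|exact Hw|exact Hn|intros _; exact Ht]. }
rewrite (sum_n_ext_loc (fun m => avg w (2 * D) _)
  (fun n => (2 * e * s n * z0 ^ n) * if Nat.eq_dec n 0 then 1 else 0)%C D).
2:{ intros n Hn; rewrite avg_scal, avg_mult_conj by (try exact Hw; lia).
    destruct (Nat.eq_dec 0 n), (Nat.eq_dec n 0); (reflexivity || lia). }
rewrite sum_n_C_delta by lia.
rewrite avg_trig by (try exact Hw; try lia; intros _; exact Ht).
rewrite (avg_const w (2 * D) 1%C), sum_n_C_scal.
unfold trig; set (S := sum_n (fun m => t m * s m * z0 ^ m)%C D); clearbody S.
destruct S as [sx sy]; destruct (s 0%nat) as [px py]; destruct (t 0%nat) as [qx qy].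
simpl in Ht, Hs; subst py qy.
unfold Cminus; unfold Cmult, Cplus, Copp, RtoC, Re; simpl; ring.
Qed.

(** Partial sums of a nonnegative series are at least [- e] for large [D], so [trig_mult_ge] applies
    and [e] tends to 0. *)
Lemma Trig_mult_ge_0 (t s : nat -> C) :
  abs_summable t 1 -> abs_summable s 1 -> Im (t 0%nat) = 0 -> Im (s 0%nat) = 0 ->
  (forall z : C, Cmod z = 1 -> 0 <= Trig t z) ->
  (forall z : C, Cmod z = 1 -> 0 <= Trig s z) ->
  forall z : C, Cmod z = 1 -> 0 <= Trig (fun n => t n * s n)%C z.
Proof.
intros Ht Hs Ht0 Hs0 HT HS z Hz.
(* For [e <= 1] the total error, [e] from the approximation plus the two terms of [trig_mult_ge], is
   at most [e * P]. *)
set (P := Rabs (Re (t 0%nat) + Re (s 0%nat)) + 2).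
assert (HP : 0 < P) by (unfold P; generalize (Rabs_pos (Re (t 0%nat) + Re (s 0%nat))); lra).
apply le_epsilon; intros e0 He0.
set (e := Rmin 1 (e0 / P)).
assert (He : 0 < e) by (apply Rmin_glb_lt; [lra|apply Rdiv_lt_0_compat; lra]).
destruct (trig_uniform t e Ht He) as [N1 H1].
destruct (trig_uniform s e Hs He) as [N2 H2].
assert (Hts : abs_summable (fun n => t n * s n)%C 1).
{ rewrite <- (Rmult_1_l 1); apply abs_summable_mult; (assumption || lra). }
destruct (trig_uniform _ e Hts He) as [N3 H3].
set (D := (N1 + N2 + N3)%nat).
assert (H := trig_mult_ge t s D e z Ht0 Hs0 Hz).
assert (Hle : 0 <= trig (fun n => t n * s n)%C D z + e * (Re (t 0%nat) + Re (s 0%nat)) + e * e).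
{ apply H; intros y Hy.
  - specialize (H1 D ltac:(unfold D; lia) y ltac:(lra)); apply Rabs_le_between in H1.
    specialize (HT y Hy); lra.
  - specialize (H2 D ltac:(unfold D; lia) y ltac:(lra)); apply Rabs_le_between in H2.
    specialize (HS y Hy); lra. }
specialize (H3 D ltac:(unfold D; lia) z ltac:(lra)); apply Rabs_le_between in H3.
assert (He1 : e <= 1) by apply Rmin_l.
assert (He2 : e * P <= e0).
{ apply Rle_trans with (e0 / P * P).
  - apply Rmult_le_compat_r; [lra|apply Rmin_r].
  - right; field; lra. }
assert (Habs := Rle_abs (Re (t 0%nat) + Re (s 0%nat))).
unfold P in He2; nra.
Qed.

(** * Fejer's theorem on convex coefficients *)

(** The Chebyshev recurrence, from [z ^ (n + 2) + z ^ n = (z + Cconj z) * z ^ (n + 1)] on the unit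
    circle. *)
Lemma Re_pow_rec (z : C) (n : nat) :
  Cmod z = 1 -> Re (z ^ S (S n))%C = 2 * Re z * Re (z ^ S n)%C - Re (z ^ n)%C.
Proof.
intros Hz.
assert (E : (z ^ S (S n) + z ^ n = RtoC (2 * Re z) * z ^ S n)%C).
{ replace (RtoC (2 * Re z)) with (z + Cconj z)%C.
  - rewrite !Cpow_S.
    replace (z ^ n)%C with (z * Cconj z * z ^ n)%C at 2
      by (rewrite (Cconj_mult_unit z Hz); ring).
    ring.
  - destruct z; unfold Cplus, Cconj, RtoC, Re; simpl; f_equal; ring. }
apply (f_equal Re) in E; rewrite re_plus, re_scal_l in E; lra.
Qed.

Lemma trig_real (c : nat -> R) (D : nat) (z : C) :
  trig (fun n => RtoC (c n)) D z = 2 * sum_n (fun n => c n * Re (z ^ n)%C) D - c 0%nat.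
Proof.
unfold trig; rewrite Re_sum_n, re_RtoC; do 2 f_equal.
apply sum_n_ext; intros n; apply re_scal_l.
Qed.

(* Fejer: multiplying by [|1 - z|^2 = 2 - 2 Re z] turns the series into
   [sum 2 (c_n - 2 c_(n+1) + c_(n+2)) (1 - Re z^(n+1))] up to a boundary term. *)
Lemma fejer_partial (c : nat -> R) (z : C) (N : nat) :
  (forall n, 0 <= c n - 2 * c (S n) + c (S (S n))) -> Cmod z = 1 ->
  2 * c N * (1 - Re (z ^ S N)%C) - 2 * c (S N) * (1 - Re (z ^ N)%C) <=
  (2 - 2 * Re z) * trig (fun n => RtoC (c n)) N z.
Proof.
intros Hc Hz; rewrite trig_real; induction N as [|N IH].
- rewrite sum_O; replace (z ^ 1)%C with z by (simpl; ring).
  change (Re (z ^ 0)%C) with 1; lra.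
- rewrite sum_n_R_S.
  assert (H1 : Re (z ^ S N)%C <= 1).
  { apply Rle_trans with (1 := Rle_abs _), Rle_trans with (1 := re_le_Cmod _).
    rewrite Cmod_pow, Hz, pow1; lra. }
  rewrite (Re_pow_rec z N Hz).
  specialize (Hc N); set (x := Re (z ^ S N)%C) in *; nra.
Qed.

Lemma ex_series_abs_summable_1 (c : nat -> R) :
  (forall n, 0 <= c n) -> ex_series c -> abs_summable (fun n => RtoC (c n)) 1.
Proof.
intros Hc; apply ex_series_ext; intros n.
rewrite pow1, Rmult_1_r, Cmod_R_pos; auto.
Qed.

(** If [Re z < 1], the boundary term of [fejer_partial] tends to 0 with [c], and one divides by
    [2 - 2 * Re z]. If [Re z = 1], every power of [z] has real part 1 and the partial sums are
    visibly nonnegative. *)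
Lemma fejer (c : nat -> R) (z : C) :
  (forall n, 0 <= c n) -> (forall n, 0 <= c n - 2 * c (S n) + c (S (S n))) ->
  ex_series c -> Cmod z = 1 -> 0 <= Trig (fun n => RtoC (c n)) z.
Proof.
intros Hc0 Hc He Hz.
assert (Ha := ex_series_abs_summable_1 c Hc0 He).
assert (Hx : forall n, -1 <= Re (z ^ n)%C <= 1).
{ intros n; apply Rabs_le_between.
  apply Rle_trans with (1 := re_le_Cmod _); rewrite Cmod_pow, Hz, pow1; lra. }
assert (Hx1 := Hx 1%nat); replace (z ^ 1)%C with z in Hx1 by (simpl; ring).
destruct (Rle_lt_or_eq_dec (Re z) 1 (proj2 Hx1)) as [Hlt|Heq].
- apply (Rmult_le_reg_l (2 - 2 * Re z)); [lra|]; rewrite Rmult_0_r.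
  apply le_epsilon; intros e Hep.
  destruct (trig_uniform _ (e / 8) Ha) as [N1 H1]; [lra|].
  assert (Hl := ex_series_lim_0 _ He).
  apply is_lim_seq_spec in Hl; destruct (Hl (mkposreal (e / 8) ltac:(lra))) as [N2 H2].
  set (N := (N1 + N2)%nat).
  specialize (H1 N ltac:(unfold N; lia) z ltac:(lra)); apply Rabs_le_between in H1.
  specialize (H2 (S N) ltac:(unfold N; lia)); simpl in H2; apply Rabs_def2 in H2.
  assert (H3 := fejer_partial c z N Hc Hz).
  assert (HxN := Hx N); assert (HxSN := Hx (S N)).
  assert (HcN := Hc0 N); assert (HcSN := Hc0 (S N)).
  assert (H4 : 0 <= 2 * c N * (1 - Re (z ^ S N)%C)) by (apply Rmult_le_pos; lra).
  assert (H5 : 2 * c (S N) * (1 - Re (z ^ N)%C) <= 4 * c (S N)) by nra.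
  nra.
- apply le_epsilon; intros e Hep.
  destruct (trig_uniform _ e Ha Hep) as [N H].
  specialize (H N (le_n N) z ltac:(lra)); apply Rabs_le_between in H.
  rewrite trig_real in H.
  assert (H1 : forall n, Re (z ^ n)%C = 1 /\ Re (z ^ S n)%C = 1).
  { induction n as [|n [IH1 IH2]].
    - split; [reflexivity|]; replace (z ^ 1)%C with z by (simpl; ring); exact Heq.
    - split; [exact IH2|]; rewrite Re_pow_rec, IH1, IH2, Heq by exact Hz; ring. }
  rewrite (sum_n_ext _ c) in H by (intros n; rewrite (proj1 (H1 n)); apply Rmult_1_r).
  generalize (sum_n_R_mono c 0 N Hc0 (Nat.le_0_l N)); rewrite sum_O.
  generalize (Hc0 0%nat); lra.
Qed.

(** * Convex sequences and the third series of coefficients *)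

Definition convex_decreasing (f : nat -> R) : Prop :=
  forall n, 0 <= f n /\ f (S n) <= f n /\ 0 <= f n - 2 * f (S n) + f (S (S n)).

(** A discrete Leibniz rule writes the second difference of the product as three nonnegative terms;
    monotonicity serves for the middle one. The tail of the kernel can thus be treated factor by
    factor. *)
Lemma convex_decreasing_mult (f g : nat -> R) :
  convex_decreasing f -> convex_decreasing g -> convex_decreasing (fun n => f n * g n).
Proof.
intros Hf Hg n.
destruct (Hf n) as [f0 [f1 f2]]; destruct (Hg n) as [g0 [g1 g2]].
destruct (Hf (S n)) as [f0' [f1' _]]; destruct (Hg (S n)) as [g0' [g1' _]].
destruct (Hf (S (S n))) as [f0'' _]; destruct (Hg (S (S n))) as [g0'' _].
split; [apply Rmult_le_pos; assumption|]; split.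
- apply Rmult_le_compat; assumption.
- replace (f n * g n - 2 * (f (S n) * g (S n)) + f (S (S n)) * g (S (S n)))
    with ((f n - 2 * f (S n) + f (S (S n))) * g n
          + 2 * (f (S n) - f (S (S n))) * (g n - g (S n))
          + f (S (S n)) * (g n - 2 * g (S n) + g (S (S n)))) by ring.
  repeat apply Rplus_le_le_0_compat; repeat apply Rmult_le_pos; lra.
Qed.

Lemma convex_decreasing_inv_affine (p q : R) :
  0 < p -> 0 <= q -> convex_decreasing (fun n => / (p + q * INR n)).
Proof.
intros Hp Hq n; rewrite !S_INR; assert (Hn := pos_INR n).
assert (H : 0 <= q * INR n) by (apply Rmult_le_pos; lra).
set (y := p + q * INR n).
replace (p + q * (INR n + 1)) with (y + q) by (unfold y; ring).
replace (p + q * (INR n + 1 + 1)) with (y + 2 * q) by (unfold y; ring).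
assert (Hy : 0 < y) by (unfold y; lra).
clearbody y; split; [apply Rlt_le, Rinv_0_lt_compat, Hy|]; split.
- apply Rinv_le_contravar; lra.
- replace (/ y - 2 * / (y + q) + / (y + 2 * q))
    with (2 * q * q / (y * (y + q) * (y + 2 * q))) by (field; lra).
  apply Rdiv_le_0_compat; [nra|].
  repeat apply Rmult_lt_0_compat; lra.
Qed.

Lemma convex_decreasing_pow (s : R) : 0 <= s <= 1 -> convex_decreasing (fun n => s ^ S n).
Proof.
intros Hs n; simpl; assert (H := pow_le s n (proj1 Hs)).
assert (HX : 0 <= s * s ^ n) by (apply Rmult_le_pos; lra).
split; [exact HX|]; split; [set (X := s * s ^ n) in *; nra|].
replace (s * s ^ n - 2 * (s * (s * s ^ n)) + s * (s * (s * s ^ n)))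
  with (s * s ^ n * ((1 - s) * (1 - s))) by ring.
repeat apply Rmult_le_pos; lra.
Qed.

(** The subtraction is one of reals: at [n = 0] the value is [1 - alpha], which vanishes for
    [alpha = 1]. Division by the weight therefore occurs only at positive indices. *)
Definition weight (alpha : R) (n : nat) : R := (INR n + 1) * (1 + alpha * (INR n - 1)).

Lemma weight_pos (alpha : R) (n : nat) : 0 < alpha -> (0 < n)%nat -> 0 < weight alpha n.
Proof.
intros Ha Hn; unfold weight; assert (H : 1 <= INR n) by (apply (le_INR 1); lia).
apply Rmult_lt_0_compat; [lra|].
assert (0 <= alpha * (INR n - 1)) by (apply Rmult_le_pos; lra); lra.
Qed.

(** The damped coefficients [c_n * s ^ n], with [c_0] lowered. Damping gains
    [2 * k * (1 - s) * (1 - x * (1 + s) / 3)] in the first convexity condition, where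
    [x = / (1 + alpha)]; as [x] and [s] are at most 1, this is at least the amount
    [2 * k * (1 - s) / 3] taken from [c_0]. *)
Definition kernel (k alpha s : R) (n : nat) : R :=
  match n with
  | O => 1 - 2 * k * (1 - s) / 3
  | S _ => 2 * k * s ^ n / weight alpha n
  end.

Lemma kernel_S (k alpha s : R) (n : nat) : 0 < alpha ->
  kernel k alpha s (S n) = 2 * k * (/ (2 + 1 * INR n) * / (1 + alpha * INR n) * s ^ S n).
Proof.
intros Ha; unfold kernel.
assert (H := weight_pos alpha (S n) Ha ltac:(lia)); unfold weight in *.
rewrite S_INR in *; assert (Hn := pos_INR n).
assert (0 <= alpha * INR n) by (apply Rmult_le_pos; lra).
field; repeat split; lra.
Qed.

Lemma kernel_convex (k alpha s : R) :
  0 < k -> 0 < alpha <= 1 -> k * (6 * alpha + 4) <= 3 * (1 + alpha) -> 0 <= s < 1 ->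
  (forall n, 0 <= kernel k alpha s n) /\
  (forall n, 0 <= kernel k alpha s n - 2 * kernel k alpha s (S n) + kernel k alpha s (S (S n))) /\
  ex_series (kernel k alpha s).
Proof.
intros Hk Ha Hle Hs.
assert (H : convex_decreasing (fun n => / (2 + 1 * INR n) * / (1 + alpha * INR n) * s ^ S n)).
{ apply (convex_decreasing_mult (fun n => / (2 + 1 * INR n) * / (1 + alpha * INR n))).
  - apply convex_decreasing_mult; apply convex_decreasing_inv_affine; lra.
  - apply convex_decreasing_pow; lra. }
assert (HS : forall n, 0 <= kernel k alpha s (S n)).
{ intros n; rewrite kernel_S by lra; apply Rmult_le_pos; [lra|apply H]. }
(* With [k <= 1] the lowered term of index 0 is still nonnegative. *)
assert (Hk1 : k <= 1) by nra.
split; [|split].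
- intros [|n]; [|apply HS]; simpl; nra.
- intros [|n].
  + rewrite !kernel_S by lra; simpl.
    set (x := / (1 + alpha * 1)).
    assert (Hx : x * (1 + alpha) = 1) by (unfold x; field; lra).
    assert (Hx0 : 0 < x) by (unfold x; apply Rinv_0_lt_compat; lra).
    replace (/ (2 + 1 * 0)) with (1 / 2) by field.
    replace (/ (1 + alpha * 0)) with 1 by (field; lra).
    replace (/ (2 + 1 * 1)) with (1 / 3) by field.
    assert (Hx1 : x <= 1) by nra.
    (* [1 >= 2 k - 2 k x / 3] is the hypothesis on [k]. *)
    assert (H1 : 0 <= 1 - 2 * k + 2 * k * x / 3).
    { assert (H2 : k * (6 * alpha + 4) * x <= 3 * (1 + alpha) * x)
        by (apply Rmult_le_compat_r; lra).
      replace (k * (6 * alpha + 4) * x) with (6 * k * (x * (1 + alpha)) - 2 * k * x) in H2 by ring.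
      replace (3 * (1 + alpha) * x) with (3 * (x * (1 + alpha))) in H2 by ring.
      rewrite Hx in H2; lra. }
    (* Beyond [H1], what is left after lowering [c_0] is [2 * k / 3 * (1 - s) * (2 * (1 - x) + x *
       (1 - s))], a combination of [H3] and [H4]. *)
    assert (H3 : 0 <= k * (1 - s) * (1 - x)) by (repeat apply Rmult_le_pos; lra).
    assert (H4 : 0 <= k * (1 - s) * (x * (1 - s))) by (repeat apply Rmult_le_pos; lra).
    nra.
  + rewrite !kernel_S by lra.
    match goal with |- 0 <= ?a => replace a with (2 * k *
     (/ (2 + 1 * INR n) * / (1 + alpha * INR n) * s ^ S n
      - 2 * (/ (2 + 1 * INR (S n)) * / (1 + alpha * INR (S n)) * s ^ S (S n))
      + / (2 + 1 * INR (S (S n))) * / (1 + alpha * INR (S (S n))) * s ^ S (S (S n)))) by ring end.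
    apply Rmult_le_pos; [lra|apply H].
- apply (ex_series_incr_1 (K := R_AbsRing) (V := R_NormedModule)).
  apply (ex_series_R_le _ (fun n => 2 * k * s ^ n)).
  + intros n; split; [apply HS|]; rewrite kernel_S by lra.
    apply Rmult_le_compat_l; [lra|].
    assert (Hn := pos_INR n).
    assert (Han : 0 <= alpha * INR n) by (apply Rmult_le_pos; lra).
    assert (H1 : / (2 + 1 * INR n) <= 1) by (rewrite <- Rinv_1; apply Rinv_le_contravar; lra).
    assert (H2 : / (1 + alpha * INR n) <= 1) by (rewrite <- Rinv_1; apply Rinv_le_contravar; lra).
    assert (H3 : 0 < / (2 + 1 * INR n)) by (apply Rinv_0_lt_compat; lra).
    assert (H4 : 0 < / (1 + alpha * INR n)) by (apply Rinv_0_lt_compat; lra).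
    assert (H5 := pow_le s n (proj1 Hs)); simpl.
    apply Rle_trans with (1 * 1 * (1 * s ^ n)); [|lra].
    repeat apply Rmult_le_compat; try lra; repeat apply Rmult_le_pos; lra.
  + apply (ex_series_scal (K := R_AbsRing) (V := R_NormedModule) (2 * k)).
    apply ex_series_geom; rewrite Rabs_pos_eq; lra.
Qed.

(** * Convolution of functions with positive real part *)

Lemma is_pseries_dilate (a : nat -> C) (r z l : C) :
  is_pseries a (r * z)%C l <-> is_pseries (fun n => a n * r ^ n)%C z l.
Proof.
rewrite !is_pseries_C; split; apply is_series_ext; intros n; rewrite Cpow_mult_l; cring.
Qed.

(* The coefficients, on the circle of radius [r], of the real trigonometric
   series of [Re u] when [u 0 = k]. *)
Definition half_coef (U : nat -> C) (r : R) (n : nat) : C :=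
  match n with O => U O | S _ => (RtoC (/ 2) * (U n * RtoC r ^ n))%C end.

(** The trigonometric series is exactly [Re (u (r * z))]: halving all coefficients and then adding
    [k / 2] restores the constant term [k]. *)
Lemma half_coef_pos (U : nat -> C) (u : C -> C) (k r : R) :
  disc_expansion U u -> U 0%nat = RtoC k -> 0 <= r < 1 ->
  (forall z, unit_disc z -> 0 < Re (u z)) ->
  abs_summable (half_coef U r) 1 /\
  forall z : C, Cmod z = 1 -> 0 <= Trig (half_coef U r) z.
Proof.
intros HU H0 Hr Hpos; split.
- apply (ex_series_R_le _ (fun n => Cmod (U n) * r ^ n)).
  + intros [|n]; rewrite pow1, Rmult_1_r; (split; [apply Cmod_ge_0|]).
    * simpl; lra.
    * unfold half_coef; rewrite !Cmod_mult, Cmod_pow, !Cmod_R_pos by lra.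
      assert (0 <= Cmod (U (S n)) * r ^ S n)
        by (apply Rmult_le_pos; [apply Cmod_ge_0|apply pow_le; lra]).
      lra.
  + exact (disc_expansion_abs_summable U u r HU Hr).
- intros z Hz.
  assert (Hrz : unit_disc (r * z)%C).
  { unfold unit_disc; rewrite Cmod_mult, Cmod_R_pos, Hz by lra; lra. }
  assert (H1 := proj1 (is_pseries_dilate _ _ _ _) (HU _ Hrz)).
  assert (H2 := is_pseries_C_plus _ _ _ _ _ (is_pseries_C_scal (RtoC (/ 2)) _ _ _ H1)
                  (is_pseries_const (RtoC (k / 2)) z)).
  assert (H3 : is_pseries (half_coef U r) z (RtoC (/ 2) * u (r * z)%C + RtoC (k / 2))%C).
  { apply is_pseries_C_ext with (2 := H2); intros [|n]; simpl.
    - rewrite H0; unfold Cplus, Cmult, RtoC; simpl; f_equal; field.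
    - ring. }
  unfold Trig; rewrite (CPSeries_unique _ _ _ H3); simpl half_coef.
  rewrite H0, re_plus, re_scal_l, !re_RtoC.
  generalize (Hpos _ Hrz); lra.
Qed.

Definition quot_coef (alpha : R) (U V : nat -> C) (n : nat) : C :=
  match n with O => RtoC 0 | S _ => (U n * V n * RtoC (/ weight alpha n))%C end.

(** Write [z] as [Cmod z] times a unimodular [y] and take the product of three nonnegative series at
    [y]. The dilations [r], [r] and [s], the last inside the kernel, multiply to [Cmod z]. The
    conclusion keeps the factor below 1 coming from the lowered [c_0]. *)
Lemma conv_pos (alpha k : R) (U V : nat -> C) (u v : C -> C) (z : C) :
  0 < alpha <= 1 -> 0 < k -> k * (6 * alpha + 4) <= 3 * (1 + alpha) ->
  disc_expansion U u -> disc_expansion V v ->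
  U 0%nat = RtoC k -> V 0%nat = RtoC k ->
  (forall z, unit_disc z -> 0 < Re (u z)) ->
  (forall z, unit_disc z -> 0 < Re (v z)) ->
  unit_disc z ->
  exists w : C, is_pseries (quot_coef alpha U V) z w /\
    0 <= k * (1 - 2 * k * (1 - sqrt (Cmod z)) / 3) + Re w.
Proof.
intros Ha Hk Hle HU HV HU0 HV0 Hu Hv Hz; unfold unit_disc in Hz.
set (s := sqrt (Cmod z)); set (r := sqrt s).
assert (Hs : 0 <= s < 1).
{ split; [apply sqrt_pos|]; rewrite <- sqrt_1; apply sqrt_lt_1_alt.
  split; [apply Cmod_ge_0|exact Hz]. }
assert (Hr : 0 <= r < 1).
{ split; [apply sqrt_pos|]; rewrite <- sqrt_1; apply sqrt_lt_1_alt; exact Hs. }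
assert (Hss : s * s = Cmod z) by (apply sqrt_sqrt, Cmod_ge_0).
assert (Hrr : r * r = s) by (apply sqrt_sqrt, Hs).
assert (Hy : exists y : C, Cmod y = 1 /\ z = (RtoC (Cmod z) * y)%C).
{ destruct (Req_dec (Cmod z) 0) as [E|E].
  - exists (RtoC 1); split; [apply Cmod_1|].
    rewrite E; apply Cmod_eq_0 in E; rewrite E; ring.
  - exists (z / RtoC (Cmod z))%C; split.
    + rewrite Cmod_div by (apply RtoC_neq_0, E).
      rewrite (Cmod_R_pos (Cmod z)) by apply Cmod_ge_0; field; exact E.
    + field; apply RtoC_neq_0, E. }
destruct Hy as [y [Hy Ezy]].
destruct (half_coef_pos U u k r HU HU0 Hr Hu) as [HtA HtP].
destruct (half_coef_pos V v k r HV HV0 Hr Hv) as [HsA HsP].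
destruct (kernel_convex k alpha s Hk Ha Hle Hs) as [Hc0 [Hc2 Hcs]].
set (c := fun n => RtoC (kernel k alpha s n)).
assert (HcA : abs_summable c 1) by (apply ex_series_abs_summable_1; assumption).
assert (HcP : forall y : C, Cmod y = 1 -> 0 <= Trig c y)
  by (intros; apply fejer; assumption).
set (t := half_coef U r) in *; set (q := half_coef V r) in *.
assert (Ht0 : Im (t 0%nat) = 0) by (simpl; rewrite HU0; reflexivity).
assert (Hq0 : Im (q 0%nat) = 0) by (simpl; rewrite HV0; reflexivity).
assert (HtqA : abs_summable (fun n => t n * q n)%C 1).
{ rewrite <- (Rmult_1_l 1); apply abs_summable_mult; (assumption || lra). }
assert (HtqP := Trig_mult_ge_0 t q HtA HsA Ht0 Hq0 HtP HsP).
assert (Htq0 : Im (t 0%nat * q 0%nat)%C = 0) by (rewrite im_mult, Ht0, Hq0; ring).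
set (x := fun n => (t n * q n * c n)%C).
assert (HxA : abs_summable x 1).
{ rewrite <- (Rmult_1_l 1); apply (abs_summable_mult (fun n => t n * q n)%C); (assumption || lra). }
assert (HxP : 0 <= Trig x y)
  by exact (Trig_mult_ge_0 _ c HtqA HcA Htq0 eq_refl HtqP HcP y Hy).
assert (Hx := CPSeries_correct x 1 y HxA ltac:(lra)).
unfold Trig in HxP; set (l := CPSeries x y) in *; clearbody l.
set (d := 1 - 2 * k * (1 - s) / 3).
assert (Hx0 : x 0%nat = RtoC (k * k * d)).
{ unfold x, t, q, c, kernel; simpl half_coef; rewrite HU0, HV0; fold d.
  rewrite !RtoC_mult; reflexivity. }
assert (Hw := is_pseries_C_scal (RtoC (2 / k)) _ _ _
  (is_pseries_C_minus _ _ _ _ _ Hx (is_pseries_const (x 0%nat) y))).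
(* For [n > 0], [x n] carries two factors 1/2 from [half_coef] and [2 * k] from the kernel, in all
   [k / 2]; the factor [2 / k] undoes this. *)
exists (RtoC (2 / k) * (l - x 0%nat))%C; split.
- rewrite Ezy; apply is_pseries_dilate.
  apply is_pseries_C_ext with (2 := Hw); intros [|n].
  + simpl; ring.
  + change (const_coef (x 0%nat) (S n)) with (RtoC 0).
    unfold x, t, q, c, half_coef, kernel, quot_coef.
    assert (Hl := weight_pos alpha (S n) (proj1 Ha) ltac:(lia)).
    rewrite <- Hss, <- Hrr.
    rewrite <- !RtoC_pow.
    set (L := weight alpha (S n)) in *; clearbody L.
    set (m := S n).
    transitivity ((U m * V m) * RtoC (2 / k * (/ 2 * / 2) * (r ^ m * r ^ m)
       * (2 * k * (r * r) ^ m / L)))%C.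
    * rewrite !RtoC_mult; ring.
    * rewrite <- (Cmult_assoc (U m * V m)%C), <- RtoC_mult; do 2 f_equal.
      rewrite !Rpow_mult_distr; field; lra.
- change (0 <= 2 * Re l - Re (x 0%nat)) in HxP.
  rewrite Hx0, re_RtoC in HxP; fold d.
  rewrite re_scal_l, Hx0; unfold Cminus; rewrite re_plus, re_opp, re_RtoC.
  replace (k * d + 2 / k * (Re l + - (k * k * d))) with ((2 * Re l - k * k * d) / k)
    by (field; lra).
  apply Rdiv_le_0_compat; lra.
Qed.

(** * The Taylor expansion of a function analytic in the disc *)

(* Bounding the sum by [/ rho] ties the size of the coefficients to the radius,
   so that one positive number controls both in the compactness argument. *)
Definition controlled (f : C -> C) (z0 : C) (rho : R) : Prop :=
  0 < rho /\ exists b : nat -> C,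
    abs_summable b rho /\ Series (fun n => Cmod (b n) * rho ^ n) <= / rho /\
    forall v : C, Cmod v <= rho -> is_pseries b v (f (z0 + v)%C).

Lemma abs_summable_Series_le (a : nat -> C) (r r' : R) :
  0 <= r' <= r -> abs_summable a r ->
  Series (fun n => Cmod (a n) * r' ^ n) <= Series (fun n => Cmod (a n) * r ^ n).
Proof.
intros Hr; apply Series_le; intros n; split.
- apply Rmult_le_pos; [apply Cmod_ge_0|apply pow_le; lra].
- apply Rmult_le_compat_l; [apply Cmod_ge_0|apply pow_incr; exact Hr].
Qed.

Lemma controlled_of_analytic (f : C -> C) (z0 : C) :
  analytic_at f z0 -> exists rho, controlled f z0 rho.
Proof.
intros [a [r [Hr H]]].
assert (Hf : forall v : C, Cmod v < r -> is_pseries a v (f (z0 + v)%C)).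
{ intros v Hv; generalize (H (z0 + v)%C).
  replace (z0 + v - z0)%C with v by ring; auto. }
assert (Ha : abs_summable a (r / 4)).
{ apply (abs_summable_of_disc a (fun v => f (z0 + v)%C) r); [lra|intros; apply Hf; assumption]. }
set (S := Series (fun n => Cmod (a n) * (r / 4) ^ n)).
assert (HS : 0 < Rabs S + 1) by (generalize (Rabs_pos S); lra).
set (rho := Rmin (r / 4) (/ (Rabs S + 1))).
assert (Hrho : 0 < rho) by (apply Rmin_glb_lt; [lra|apply Rinv_0_lt_compat, HS]).
assert (Hrho1 : rho <= r / 4) by apply Rmin_l.
exists rho; split; [exact Hrho|]; exists a; split; [|split].
- apply (abs_summable_le a (r / 4)); [lra|exact Ha].
- apply Rle_trans with S; [apply abs_summable_Series_le; [lra|exact Ha]|].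
  apply Rle_trans with (Rabs S + 1); [generalize (Rle_abs S); lra|].
  rewrite <- (Rinv_inv (Rabs S + 1)).
  apply Rinv_le_contravar; [exact Hrho|apply Rmin_r].
- intros v Hv; apply Hf; lra.
Qed.

Lemma controlled_smaller (f : C -> C) (z0 : C) (rho rho' : R) :
  controlled f z0 rho -> 0 < rho' <= rho -> controlled f z0 rho'.
Proof.
intros [Hrho [b [Hb [HS Hf]]]] H; split; [lra|]; exists b; split; [|split].
- apply (abs_summable_le b rho); [lra|exact Hb].
- apply Rle_trans with (2 := Rinv_le_contravar rho' rho (proj1 H) (proj2 H)).
  apply Rle_trans with (2 := HS); apply abs_summable_Series_le; [lra|exact Hb].
- intros v Hv; apply Hf; lra.
Qed.

(** Re-expansion does not increase the sum of absolute values, and [/ rho] is below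
    [/ (rho / 2)]. *)
Lemma controlled_recenter (f : C -> C) (z0 z1 : C) (rho : R) :
  controlled f z0 rho -> Cmod (z1 - z0)%C <= rho / 2 -> controlled f z1 (rho / 2).
Proof.
intros [Hrho [b [Hb [HS Hf]]]] H.
destruct (recenter b (z1 - z0)%C (rho / 2) rho) as [d [_ [Hd [HdS Hdf]]]];
  [lra|lra|exact Hb|].
split; [lra|]; exists d; split; [exact Hd|]; split.
- apply Rle_trans with (1 := HdS), Rle_trans with (1 := HS).
  apply Rinv_le_contravar; lra.
- intros v Hv; apply Hdf; [exact Hv|].
  replace (z1 + v)%C with (z0 + (z1 - z0 + v))%C by ring.
  apply Hf; apply Rle_trans with (1 := Cmod_triangle _ _); lra.
Qed.

Lemma controlled_uniform (f : C -> C) (R0 : R) :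
  analytic_in_disc f -> R0 < 1 ->
  exists rho, 0 < rho /\ forall z : C, Cmod z <= R0 -> controlled f z rho.
Proof.
intros Hf HR.
(* The gauge for compactness of the square. The cap [(1 - R0) / 2] prevents centres outside the disc
   from covering points with [Cmod z <= R0]; the factor 4 puts a covered point within half the
   controlled radius. *)
assert (Hd : forall u v : R, {d : posreal |
  d <= (1 - R0) / 2 /\ (unit_disc (u, v) -> controlled f (u, v) (4 * d))}).
{ intros u v; apply constructive_indefinite_description.
  destruct (classic (unit_disc (u, v))) as [Huv|Huv].
  - destruct (controlled_of_analytic f _ (Hf _ Huv)) as [rho Hg].
    assert (H : 0 < Rmin ((1 - R0) / 2) (rho / 4))
      by (apply Rmin_glb_lt; [lra|destruct Hg; lra]).
    exists (mkposreal _ H); simpl; split; [apply Rmin_l|]; intros _.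
    apply (controlled_smaller f _ rho); [exact Hg|].
    generalize (Rmin_r ((1 - R0) / 2) (rho / 4)); lra.
  - assert (H : 0 < (1 - R0) / 2) by lra.
    exists (mkposreal _ H); simpl; split; [lra|]; intros; contradiction. }
destruct (compactness_value_2d (-1) 1 (-1) 1 (fun u v => proj1_sig (Hd u v))) as [d H].
exists d; split; [apply cond_pos|]; intros z Hz.
assert (Hzm := Rmax_Cmod z).
assert (H1 : -1 <= fst z <= 1).
{ apply Rabs_le_between; generalize (Rmax_l (Rabs (fst z)) (Rabs (snd z))); lra. }
assert (H2 : -1 <= snd z <= 1).
{ apply Rabs_le_between; generalize (Rmax_r (Rabs (fst z)) (Rabs (snd z))); lra. }
destruct (NNPP _ (H (fst z) (snd z) H1 H2)) as [u [v [_ [_ [Hu [Hv Huv]]]]]].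
destruct (Hd u v) as [e [He Hg]]; simpl in Hu, Hv, Huv.
assert (Hep := cond_pos e).
assert (Hdist : Cmod (z - (u, v))%C <= 2 * e).
{ apply Rle_trans with (1 := Cmod_2Rmax _).
  assert (Hm : Rmax (Rabs (fst (z - (u, v))%C)) (Rabs (snd (z - (u, v))%C)) <= e).
  { apply Rmax_lub; simpl; left; assumption. }
  assert (Hs2 : sqrt 2 <= 2).
  { rewrite <- (sqrt_square 2) at 2 by lra; apply sqrt_le_1_alt; lra. }
  apply Rmult_le_compat; [apply sqrt_pos| |exact Hs2|exact Hm].
  apply Rle_trans with (2 := Rmax_l _ _), Rabs_pos. }
destruct (classic (unit_disc (u, v))) as [Hin|Hout].
- apply (controlled_smaller f z (4 * e / 2)); [|generalize (cond_pos d); lra].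
  apply (controlled_recenter f (u, v)); [apply Hg, Hin|lra].
- exfalso; apply Hout; unfold unit_disc.
  assert (Hgap : Cmod (z - (u, v))%C < 1 - R0).
  { apply Rle_lt_trans with (sqrt 2 * e).
    - apply Rle_trans with (1 := Cmod_2Rmax _).
      apply Rmult_le_compat_l; [apply sqrt_pos|].
      apply Rmax_lub; simpl; left; assumption.
    - assert (Hs2 : sqrt 2 < 2).
      { rewrite <- (sqrt_square 2) at 2 by lra; apply sqrt_lt_1_alt; lra. }
      nra. }
  replace ((u, v) : C) with (z + - (z - (u, v)))%C by ring.
  apply Rle_lt_trans with (1 := Cmod_triangle _ _); rewrite Cmod_opp; lra.
Qed.

(** Cauchy's estimate through [trig_coeff_le]: the trigonometric series on radius [r] is [2 * Re f]
    minus the real part of the constant term, hence at most [3 * B] in absolute value. *)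
Lemma pseries_coeff_le (a : nat -> C) (f : C -> C) (r B : R) (n : nat) :
  0 <= r -> abs_summable a r ->
  (forall z : C, Cmod z <= r -> is_pseries a z (f z) /\ Cmod (f z) <= B) ->
  Cmod (a n) * r ^ n <= 3 * B.
Proof.
intros Hr Ha Hf.
assert (HB : 0 <= B).
{ apply Rle_trans with (1 := Cmod_ge_0 (f 0%C)), Hf; rewrite Cmod_0; exact Hr. }
assert (H0 : Cmod (a 0%nat) <= B).
{ destruct (Hf 0%C) as [H1 H2]; [rewrite Cmod_0; exact Hr|].
  rewrite <- (is_pseries_at_0 a _ H1); exact H2. }
destruct n as [|n]; [simpl; lra|].
set (t := fun n => (a n * RtoC r ^ n)%C).
assert (Ht : forall k, Cmod (t k) = Cmod (a k) * r ^ k).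
{ intros k; unfold t; rewrite Cmod_mult, Cmod_pow, (Cmod_R_pos r Hr); reflexivity. }
rewrite <- Ht; apply trig_coeff_le; [|lia|].
- apply ex_series_ext with (2 := Ha); intros k; rewrite Ht, pow1, Rmult_1_r; reflexivity.
- intros z Hz.
  assert (Hrz : Cmod (r * z)%C <= r) by (rewrite Cmod_mult, (Cmod_R_pos r Hr), Hz; lra).
  destruct (Hf _ Hrz) as [H1 H2]; apply is_pseries_dilate in H1.
  unfold Trig; rewrite (CPSeries_unique t z _ H1).
  assert (H3 := re_le_Cmod (f (r * z)%C)).
  assert (H4 := re_le_Cmod (t 0%nat)).
  rewrite Ht, pow_O, Rmult_1_r in H4.
  apply Rabs_le_between in H3; apply Rabs_le_between in H4; apply Rabs_le_between.
  lra.
Qed.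

(** Terms with [n < m] vanish; setting [n = m + j] exhibits the [m]-th Taylor coefficient at [z] as
    a power series in [z], so that Cauchy estimates apply to it. *)
Lemma recentered_coeff (a : nat -> C) (z l : C) (m : nat) :
  is_series (fun n => a n * (binom n m * z ^ (n - m)))%C l ->
  is_pseries (fun j => RtoC (binom (m + j) m) * a (m + j)%nat)%C z l.
Proof.
intros H; apply is_pseries_C.
apply is_series_ext with (fun j => a (m + j)%nat * (binom (m + j) m * z ^ (m + j - m)))%C.
- intros j; replace (m + j - m)%nat with j by lia; cring.
- destruct m as [|m]; [exact H|].
  apply (is_series_incr_n (fun n => a n * (binom n (S m) * z ^ (n - S m)))%C); [lia|].
  assert (E : sum_n (fun n => a n * (binom n (S m) * z ^ (n - S m)))%C m = RtoC 0).
  { rewrite (sum_n_ext_loc _ (fun _ => 0 * 1)%C), sum_n_C_scal.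
    - cring.
    - intros k Hk; rewrite binom_0 by lia; cring. }
  refine (eq_ind _ (is_series _) H _ _).
  transitivity (l + 0)%C; [cring|exact (f_equal (Cplus l) (eq_sym E))].
Qed.

(** Control bounds the [m]-th Taylor coefficient at [z] by [rho ^ (- m - 1)], uniformly in [z].
    Cauchy's estimate for it as a function of [z] gives [Hterm]. Replacing [rho] by [rho / 2] brings
    a factor [2 ^ (- m)], and summing over [m] rebuilds the binomial expansion of
    [(r + rho / 2) ^ N]. *)
Lemma coeff_growth (f : C -> C) (a : nat -> C) (r R0 rho : R) (N : nat) :
  0 <= r < R0 -> (forall z : C, Cmod z < R0 -> is_pseries a z (f z)) ->
  (forall z : C, Cmod z < R0 -> controlled f z rho) ->
  Cmod (a N) * (r + rho / 2) ^ N <= 6 / rho.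
Proof.
intros Hr Ha Hg.
assert (Hrho : 0 < rho) by (destruct (Hg 0%C); [rewrite Cmod_0; lra|assumption]).
assert (Hasum : forall s, 0 <= s < R0 -> abs_summable a s).
{ intros s Hs; apply (abs_summable_of_disc a f R0); [exact Hs|intros; apply Ha; assumption]. }
assert (Hcoef : forall z : C, Cmod z < R0 -> exists b : nat -> C,
  (forall m, Cmod (b m) * rho ^ m <= / rho) /\
  (forall m, is_pseries (fun j => RtoC (binom (m + j) m) * a (m + j)%nat)%C z (b m))).
{ intros z Hz; destruct (Hg z Hz) as [_ [b [Hb [HbS Hbf]]]].
  assert (Hz0 := Cmod_ge_0 z).
  set (s := (Cmod z + R0) / 2).
  destruct (recenter a z (s - Cmod z) s) as [d [Hd [_ [_ Hdf]]]];
    [unfold s; lra|lra|apply Hasum; unfold s; lra|].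
  (* The controlled local expansion is the re-expansion of [a], as both represent [f] near [z]. *)
  assert (Hbd : forall m, d m = b m).
  { apply (pseries_coeff_unique d b (fun v => f (z + v)%C) (Rmin rho (s - Cmod z))).
    - apply Rmin_glb_lt; [exact Hrho|unfold s; lra].
    - intros v Hv; apply Hdf.
      + left; apply Rlt_le_trans with (1 := Hv), Rmin_r.
      + apply Ha; apply Rle_lt_trans with (1 := Cmod_triangle _ _).
        generalize (Rmin_r rho (s - Cmod z)); unfold s in *; lra.
    - intros v Hv; apply Hbf; left; apply Rlt_le_trans with (1 := Hv), Rmin_l. }
  exists b; split.
  - intros m; apply Rle_trans with (2 := HbS).
    apply (term_le_Series (fun n => Cmod (b n) * rho ^ n)); [|exact Hb].
    intros k; apply Rmult_le_pos; [apply Cmod_ge_0|apply pow_le; lra].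
  - intros m; apply recentered_coeff; rewrite <- Hbd; apply Hd. }
assert (Hterm : forall m, (m <= N)%nat ->
  Cmod (a N) * (binom N m * r ^ (N - m) * rho ^ m) <= 3 / rho).
{ intros m Hm.
  set (A := fun j => (RtoC (binom (m + j) m) * a (m + j)%nat)%C).
  assert (HB : forall z : C, Cmod z < R0 ->
    exists l, is_pseries A z l /\ Cmod l <= / rho * / rho ^ m).
  { intros z Hz; destruct (Hcoef z Hz) as [b [Hb1 Hb2]].
    exists (b m); split; [apply Hb2|].
    apply (Rmult_le_reg_r (rho ^ m)); [apply pow_lt, Hrho|].
    rewrite Rmult_assoc, Rinv_l, Rmult_1_r by (apply pow_nonzero; lra); apply Hb1. }
  assert (HA : abs_summable A r).
  { set (s := (r + R0) / 2).
    destruct (HB (RtoC s)) as [l [Hl _]]; [unfold s; rewrite Cmod_R_pos; lra|].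
    apply (is_pseries_abs_summable A (RtoC s) l r Hl); unfold s; rewrite Cmod_R_pos; lra. }
  assert (H : Cmod (A (N - m)%nat) * r ^ (N - m) <= 3 * (/ rho * / rho ^ m)).
  { apply (pseries_coeff_le A (CPSeries A)); [lra|exact HA|].
    intros z Hz; destruct (HB z) as [l [Hl1 Hl2]]; [lra|].
    rewrite (CPSeries_unique _ _ _ Hl1); split; assumption. }
  unfold A in H; rewrite Cmod_mult, Cmod_R_pos in H by apply binom_ge_0.
  replace (m + (N - m))%nat with N in H by lia.
  apply (Rmult_le_compat_r (rho ^ m)) in H; [|apply pow_le; lra].
  replace (3 * (/ rho * / rho ^ m) * rho ^ m) with (3 / rho) in H
    by (field; split; try lra; apply pow_nonzero; lra).
  lra. }
rewrite <- (pow_binomial r (rho / 2) N N) by lia.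
rewrite <- (sum_n_mult_l (K := R_Ring)).
apply Rle_trans with (sum_n (fun m => 3 / rho * (/ 2) ^ m) N).
- assert (Hle : forall D, (D <= N)%nat ->
    sum_n (fun m => mult (Cmod (a N)) (binom N m * r ^ (N - m) * (rho / 2) ^ m)) D <=
    sum_n (fun m => 3 / rho * (/ 2) ^ m) D).
  { assert (Hm : forall m, (m <= N)%nat ->
      Cmod (a N) * (binom N m * r ^ (N - m) * (rho / 2) ^ m) <= 3 / rho * (/ 2) ^ m).
    { intros m Hm; unfold Rdiv at 1; rewrite Rpow_mult_distr.
      generalize (Rmult_le_compat_r ((/ 2) ^ m) _ _ (pow_le (/ 2) m ltac:(lra)) (Hterm m Hm)).
      lra. }
    induction D as [|D IH]; intros HD.
    - rewrite !sum_O; apply Hm, HD.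
    - rewrite !sum_n_R_S; apply Rplus_le_compat; [apply IH; lia|apply Hm, HD]. }
  apply Hle, le_n.
- rewrite (sum_n_mult_l (K := R_Ring) (3 / rho) (fun m => (/ 2) ^ m)).
  change (3 / rho * sum_n (fun m => (/ 2) ^ m) N <= 6 / rho).
  replace (6 / rho) with (3 / rho * 2) by (field; lra).
  apply Rmult_le_compat_l; [apply Rlt_le, Rdiv_lt_0_compat; lra|].
  assert (Hgeo := is_series_geom (/ 2) ltac:(rewrite Rabs_pos_eq; lra)).
  apply Rle_trans with (Series (fun m => (/ 2) ^ m)); [|rewrite (is_series_unique _ _ Hgeo); lra].
  apply sum_n_R_le_Series; [intros; apply pow_le; lra|eexists; exact Hgeo].
Qed.

Lemma expansion_extend (f : C -> C) (a : nat -> C) (R0 rho : R) :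
  rho <= R0 -> (forall z : C, Cmod z < R0 -> is_pseries a z (f z)) ->
  (forall z : C, Cmod z < R0 -> controlled f z rho) ->
  forall z : C, Cmod z < R0 + rho / 8 -> is_pseries a z (f z).
Proof.
intros HR Ha Hg z Hz.
destruct (Rlt_le_dec (Cmod z) R0) as [Hlt|Hge]; [apply Ha, Hlt|].
destruct (Rlt_le_dec 0 rho) as [Hrho|Hrho]; [|exfalso; lra].
assert (Has : abs_summable a (R0 + rho / 8)).
{ apply (abs_summable_of_bound a (6 / rho) _ (R0 - rho / 4 + rho / 2)); [lra|].
  intros n; apply (coeff_growth f a _ R0); (assumption || lra). }
(* An inner point on the ray of [z]. Near it the expansion of [f] and the re-expansion of [a] have
   equal coefficients, and both discs of convergence contain [z]. *)
set (z1 := (RtoC ((R0 - rho / 8) / Cmod z) * z)%C).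
assert (Hz1 : Cmod z1 = R0 - rho / 8).
{ unfold z1; rewrite Cmod_mult, Cmod_R_pos by (apply Rdiv_le_0_compat; lra).
  field; lra. }
assert (Hzz1 : Cmod (z - z1)%C < rho / 4).
{ replace (z - z1)%C with (RtoC (1 - (R0 - rho / 8) / Cmod z) * z)%C
    by (unfold z1; rewrite RtoC_minus; ring).
  assert (Hq : (R0 - rho / 8) / Cmod z <= 1) by (apply Rle_div_l; lra).
  rewrite Cmod_mult, Cmod_R_pos by lra.
  replace ((1 - (R0 - rho / 8) / Cmod z) * Cmod z) with (Cmod z - (R0 - rho / 8))
    by (field; lra).
  lra. }
destruct (Hg z1 ltac:(lra)) as [_ [b [_ [_ Hbf]]]].
destruct (recenter a z1 (rho / 4) (R0 + rho / 8)) as [d [_ [_ [_ Hdf]]]];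
  [lra|lra|exact Has|].
assert (Hbd : forall n, b n = d n).
{ apply (pseries_coeff_unique b d (fun v => f (z1 + v)%C) (rho / 8)); [lra| |].
  - intros v Hv; apply Hbf; lra.
  - intros v Hv; apply Hdf; [lra|]; apply Ha.
    apply Rle_lt_trans with (1 := Cmod_triangle _ _); lra. }
assert (HF := CPSeries_correct a (R0 + rho / 8) z Has ltac:(lra)).
assert (Ez : (z1 + (z - z1))%C = z) by ring.
assert (H1 := Hbf (z - z1)%C ltac:(lra)); rewrite Ez in H1.
assert (H2 : is_pseries d (z - z1)%C (CPSeries a z)).
{ apply Hdf; [lra|]; rewrite Ez; exact HF. }
apply (is_pseries_C_ext b d _ _ Hbd) in H1.
rewrite (is_pseries_C_unique _ _ _ _ H1 H2); exact HF.
Qed.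

(** Take the least upper bound of the radii on which the expansion at 0 represents [f]. It is itself
    such a radius, and if it were below 1, uniform control and [expansion_extend] would enlarge
    it. *)
Lemma analytic_disc_expansion (f : C -> C) :
  analytic_in_disc f -> exists a, disc_expansion a f.
Proof.
intros Hf.
destruct (Hf 0%C) as [a [r [Hr Ha]]]; [unfold unit_disc; rewrite Cmod_0; lra|].
exists a.
set (E := fun s => 0 <= s <= 1 /\ forall z : C, Cmod z < s -> is_pseries a z (f z)).
assert (HE : E (Rmin r 1)).
{ split; [split; [apply Rmin_glb; lra|apply Rmin_r]|].
  intros z Hz; replace z with (z - 0)%C at 1 by ring; apply Ha.
  replace (z - 0)%C with z by ring; apply Rlt_le_trans with (1 := Hz), Rmin_l. }
destruct (completeness E) as [R0 [Hub Hlub]].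
{ exists 1; intros s [Hs _]; lra. }
{ exists (Rmin r 1); exact HE. }
assert (HR0 : 0 < R0) by (apply Rlt_le_trans with (2 := Hub _ HE), Rmin_glb_lt; lra).
assert (HR1 : R0 <= 1) by (apply Hlub; intros s [Hs _]; lra).
assert (HRE : forall z : C, Cmod z < R0 -> is_pseries a z (f z)).
{ intros z Hz; apply NNPP; intros Hn.
  assert (H : R0 <= Cmod z); [|lra].
  apply Hlub; intros s [_ Hs].
  destruct (Rle_lt_dec s (Cmod z)) as [H|H]; [exact H|].
  contradiction (Hn (Hs z H)). }
destruct (Rle_lt_or_eq_dec R0 1 HR1) as [Hlt|Heq].
- exfalso.
  destruct (controlled_uniform f R0 Hf Hlt) as [rho0 [Hrho0 Hg]].
  set (rho := Rmin rho0 (Rmin R0 (1 - R0))).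
  assert (Hrho : 0 < rho) by (repeat apply Rmin_glb_lt; lra).
  assert (H1 : rho <= R0) by (apply Rle_trans with (1 := Rmin_r _ _), Rmin_l).
  assert (H2 : rho <= 1 - R0) by (apply Rle_trans with (1 := Rmin_r _ _), Rmin_r).
  assert (H3 : E (R0 + rho / 8)).
  { split; [lra|].
    apply expansion_extend; [exact H1|exact HRE|].
    intros z Hz; apply (controlled_smaller f z rho0); [apply Hg; lra|].
    split; [exact Hrho|apply Rmin_l]. }
  generalize (Hub _ H3); lra.
- intros z Hz; apply HRE; rewrite Heq; exact Hz.
Qed.

(** * Convolution in the class of harmonic functions *)

Lemma unit_disc_0 : unit_disc (RtoC 0).
Proof. unfold unit_disc; rewrite Cmod_0; lra. Qed.

Lemma disc_expansion_ext (a : nat -> C) (f g : C -> C) :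
  (forall z, unit_disc z -> f z = g z) -> disc_expansion a f -> disc_expansion a g.
Proof. intros E H z Hz; rewrite <- (E z Hz); apply H, Hz. Qed.

(** On the circle of radius 1/2, where the coefficients are absolutely summable, the trigonometric
    series vanishes; [trig_coeff_le] with bound 0 removes every coefficient. *)
Lemma Re_zero_expansion (c : nat -> C) (u : C -> C) :
  disc_expansion c u -> u (RtoC 0) = RtoC 0 -> (forall z, unit_disc z -> Re (u z) = 0) ->
  forall z, unit_disc z -> u z = RtoC 0.
Proof.
intros Hc Hu0 HRe.
assert (Hc0 : c 0%nat = RtoC 0).
{ rewrite <- Hu0; symmetry; apply is_pseries_at_0, Hc, unit_disc_0. }
set (t := fun n => (c n * RtoC (/ 2) ^ n)%C).
assert (Ht : forall n, Cmod (t n) = Cmod (c n) * (/ 2) ^ n).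
{ intros n; unfold t; rewrite Cmod_mult, Cmod_pow, Cmod_R_pos by lra; reflexivity. }
assert (HtA : abs_summable t 1).
{ apply ex_series_ext with (2 := disc_expansion_abs_summable c u (/ 2) Hc ltac:(lra)).
  intros n; rewrite Ht, pow1, Rmult_1_r; reflexivity. }
assert (Hcn : forall n, c n = RtoC 0).
{ intros [|n]; [exact Hc0|].
  assert (H : Cmod (t (S n)) <= 0).
  { apply trig_coeff_le; [exact HtA|lia|]; intros z Hz.
    assert (Hz2 : unit_disc (RtoC (/ 2) * z)%C).
    { unfold unit_disc; rewrite Cmod_mult, Hz, Cmod_R_pos by lra; lra. }
    assert (H1 := proj1 (is_pseries_dilate _ _ _ _) (Hc _ Hz2)).
    unfold Trig; rewrite (CPSeries_unique t z _ H1), (HRe _ Hz2).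
    unfold t; rewrite Hc0, Cmult_0_l, re_RtoC.
    replace (2 * 0 - 0) with 0 by ring; rewrite Rabs_R0; lra. }
  rewrite Ht in H.
  apply Cmod_eq_0, Rle_antisym; [|apply Cmod_ge_0].
  apply (Rmult_le_reg_r ((/ 2) ^ S n)); [apply pow_lt; lra|lra]. }
intros z Hz; apply (is_pseries_C_unique c z); [apply Hc, Hz|].
apply is_pseries_C_ext with (2 := is_pseries_const (RtoC 0) z).
intros [|n]; rewrite Hcn; reflexivity.
Qed.

(** With [X = h - h1] and [Y = g1 - g] one has [X = Cconj Y]. Hence [X - Y] and [Ci * (X + Y)] have
    zero real part, and both vanish at 0. *)
Lemma harmonic_decomp_unique (f h g h1 g1 : C -> C) :
  harmonic_decomp f h g -> harmonic_decomp f h1 g1 ->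
  forall z, unit_disc z -> h z = h1 z /\ g z = g1 z.
Proof.
intros [Hh [Hg [h0 [_ [g0 Hf]]]]] [Hh1 [Hg1 [h10 [_ [g10 Hf1]]]]].
destruct (analytic_disc_expansion h Hh) as [a Ha].
destruct (analytic_disc_expansion g Hg) as [b Hb].
destruct (analytic_disc_expansion h1 Hh1) as [a1 Ha1].
destruct (analytic_disc_expansion g1 Hg1) as [b1 Hb1].
assert (E : forall z, unit_disc z -> (h z - h1 z = Cconj (g1 z - g z))%C).
{ intros z Hz; rewrite Cminus_conj; apply Ceq_minus.
  replace (h z - h1 z - (Cconj (g1 z) - Cconj (g z)))%C
    with (h z + Cconj (g z) - (h1 z + Cconj (g1 z)))%C by ring.
  rewrite <- (Hf z Hz), <- (Hf1 z Hz); ring. }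
assert (H1 : forall z, unit_disc z -> ((h z - h1 z) - (g1 z - g z) = 0)%C).
{ apply (Re_zero_expansion (fun n => (a n - a1 n) - (b1 n - b n))%C
    (fun z => (h z - h1 z) - (g1 z - g z))%C).
  - intros z Hz; apply is_pseries_C_minus; apply is_pseries_C_minus; auto.
  - rewrite h0, h10, g0, g10; ring.
  - intros z Hz; rewrite (E z Hz).
    unfold Cminus at 1; rewrite re_plus, re_opp, re_conj; ring. }
assert (H2 : forall z, unit_disc z -> (Ci * ((h z - h1 z) + (g1 z - g z)) = 0)%C).
{ apply (Re_zero_expansion (fun n => Ci * ((a n - a1 n) + (b1 n - b n)))%C
    (fun z => Ci * ((h z - h1 z) + (g1 z - g z)))%C).
  - intros z Hz; apply is_pseries_C_scal, is_pseries_C_plus; apply is_pseries_C_minus; auto.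
  - rewrite h0, h10, g0, g10; ring.
  - intros z Hz; rewrite (E z Hz), Cmult_comm, re_mult_Ci.
    destruct (g1 z - g z)%C as [x y]; simpl; ring. }
intros z Hz; specialize (H1 z Hz); specialize (H2 z Hz).
assert (H3 : ((h z - h1 z) + (g1 z - g z) = 0)%C).
{ replace ((h z - h1 z) + (g1 z - g z))%C
    with (/ Ci * (Ci * ((h z - h1 z) + (g1 z - g z))))%C by (field; apply Ci_nz).
  rewrite H2; ring. }
split; apply Ceq_minus.
- replace (h z - h1 z)%C with (/ 2 * (((h z - h1 z) - (g1 z - g z)) +
    ((h z - h1 z) + (g1 z - g z))))%C by (field; apply RtoC_neq_0; lra).
  rewrite H1, H3; ring.
- replace (g z - g1 z)%C with (/ 2 * (((h z - h1 z) - (g1 z - g z)) -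
    ((h z - h1 z) + (g1 z - g z))))%C by (field; apply RtoC_neq_0; lra).
  rewrite H1, H3; ring.
Qed.

Lemma disc_coeffs_correct (f : C -> C) :
  analytic_in_disc f -> disc_expansion (disc_coeffs f) f.
Proof.
intros H; unfold disc_coeffs.
exact (epsilon_spec (inhabits (fun _ : nat => RtoC 0)) (fun a => disc_expansion a f)
  (analytic_disc_expansion f H)).
Qed.

Lemma parts_correct (f : C -> C) :
  class_H f -> harmonic_decomp f (fst (parts f)) (snd (parts f)).
Proof.
intros [h [g H]]; unfold parts.
apply (epsilon_spec (inhabits (fun _ : C => RtoC 0, fun _ : C => RtoC 0))
  (fun hg => harmonic_decomp f (fst hg) (snd hg))).
exists (h, g); exact H.
Qed.

(** * The operator that defines the class, and its coefficients *)

Definition op_coef (alpha : R) (a : nat -> C) (n : nat) : C := (RtoC (weight alpha n) * a (S n))%C.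

Definition op (alpha : R) (h : C -> C) (z : C) : C :=
  (RtoC (1 - alpha) * C_derive h z + RtoC alpha * z * C_derive (C_derive h) z)%C.

Lemma is_pseries_mult_var (a : nat -> C) (z l : C) :
  is_pseries a z l ->
  is_pseries (fun n => match n with O => RtoC 0 | S k => a k end) z (z * l)%C.
Proof.
intros H; apply is_pseries_C in H; apply is_pseries_C, is_series_decr_1.
apply (is_series_scal (K := C_AbsRing) (V := C_NormedModule) z) in H.
apply is_series_ext with (fun n => z * (a n * z ^ n))%C.
- intros n; rewrite Cpow_S; cring.
- refine (eq_ind _ (is_series _) H _ _).
  change (z * l = z * l + - (0 * 1))%C; ring.
Qed.

(** The weight arises as [(1 - alpha) * (n + 1) + alpha * n * (n + 1)]. *)
Lemma op_expansion (alpha : R) (a : nat -> C) (h : C -> C) :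
  disc_expansion a h -> disc_expansion (op_coef alpha a) (op alpha h).
Proof.
intros H z Hz.
assert (H1 := disc_expansion_C_derive a h H).
assert (H2 := disc_expansion_C_derive _ _ H1).
assert (H3 := is_pseries_C_plus _ _ _ _ _
  (is_pseries_C_scal (RtoC (1 - alpha)) _ _ _ (H1 z Hz))
  (is_pseries_C_scal (RtoC alpha) _ _ _ (is_pseries_mult_var _ _ _ (H2 z Hz)))).
unfold op; rewrite <- (Cmult_assoc (RtoC alpha)).
apply is_pseries_C_ext with (2 := H3); intros [|n]; unfold op_coef, dcoef, weight.
- replace ((INR 0 + 1) * (1 + alpha * (INR 0 - 1))) with (1 - alpha) by (simpl; ring).
  change (INR 1) with 1; ring.
- rewrite !S_INR, !RtoC_mult, !RtoC_minus, !RtoC_plus, !RtoC_mult, RtoC_minus, !RtoC_plus; ring.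
Qed.

Lemma op_disc_ext (alpha : R) (a : nat -> C) (h h1 : C -> C) (z : C) :
  disc_expansion a h -> disc_expansion a h1 -> unit_disc z -> op alpha h z = op alpha h1 z.
Proof.
intros H H1 Hz; apply (is_pseries_C_unique (op_coef alpha a) z); apply op_expansion; assumption.
Qed.

Lemma disc_expansion_at_0 (a : nat -> C) (f : C -> C) : disc_expansion a f -> a 0%nat = f (RtoC 0).
Proof. intros H; symmetry; apply is_pseries_at_0, H, unit_disc_0. Qed.

Lemma disc_expansion_C_derive_0 (a : nat -> C) (f : C -> C) :
  disc_expansion a f -> a 1%nat = C_derive f (RtoC 0).
Proof.
intros H; rewrite <- (disc_expansion_at_0 _ _ (disc_expansion_C_derive a f H)).
unfold dcoef; change (INR 1) with 1; ring.
Qed.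

(** The witnesses of class membership may differ from [parts f] outside the disc. They agree inside,
    so they share coefficients, through which the derivatives and the inequality are transferred. *)
Lemma class_P0H_coeffs (alpha M : R) (f : C -> C) :
  class_P0H alpha M f ->
  let h := fst (parts f) in let g := snd (parts f) in
  let a := disc_coeffs h in let b := disc_coeffs g in
  disc_expansion a h /\ disc_expansion b g /\
  a 0%nat = RtoC 0 /\ a 1%nat = RtoC 1 /\ b 0%nat = RtoC 0 /\ b 1%nat = RtoC 0 /\
  forall z, unit_disc z -> Re (op alpha h z) > - M + Cmod (op alpha g z).
Proof.
intros [h1 [g1 [Hd1 [Hg1 Hineq]]]] h g a b.
assert (Hd : harmonic_decomp f h g) by (apply parts_correct; exists h1, g1; exact Hd1).
assert (Heq := harmonic_decomp_unique f h g h1 g1 Hd Hd1).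
destruct Hd as [Hh [Hg [h0 [h'0 [g0 _]]]]].
assert (Ha : disc_expansion a h) by apply (disc_coeffs_correct h Hh).
assert (Hb : disc_expansion b g) by apply (disc_coeffs_correct g Hg).
assert (Ha1 : disc_expansion a h1)
  by (apply (disc_expansion_ext a h); [intros z Hz; apply Heq, Hz|exact Ha]).
assert (Hb1 : disc_expansion b g1)
  by (apply (disc_expansion_ext b g); [intros z Hz; apply Heq, Hz|exact Hb]).
split; [exact Ha|]; split; [exact Hb|].
split; [rewrite (disc_expansion_at_0 a h Ha); exact h0|].
split; [rewrite (disc_expansion_C_derive_0 a h Ha); exact h'0|].
split; [rewrite (disc_expansion_at_0 b g Hb); exact g0|].
split; [rewrite (disc_expansion_C_derive_0 b g1 Hb1); exact Hg1|].
intros z Hz.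
rewrite (op_disc_ext alpha a h h1 z Ha Ha1 Hz), (op_disc_ext alpha b g g1 z Hb Hb1 Hz).
exact (Hineq z Hz).
Qed.

(** Each factor is absolutely summable at radius [sqrt (Cmod z)], and the radii multiply. *)
Lemma hadamard_expansion (f g : C -> C) :
  disc_expansion (disc_coeffs f) f -> disc_expansion (disc_coeffs g) g ->
  disc_expansion (fun n => disc_coeffs f n * disc_coeffs g n)%C (hadamard f g).
Proof.
intros Hf Hg z Hz; unfold unit_disc in Hz.
set (r := sqrt (Cmod z)).
assert (Hr : 0 <= r < 1).
{ split; [apply sqrt_pos|]; rewrite <- sqrt_1; apply sqrt_lt_1_alt.
  split; [apply Cmod_ge_0|exact Hz]. }
apply (CPSeries_correct _ (r * r)).
- apply abs_summable_mult; try lra;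
    [apply (disc_expansion_abs_summable _ f)|apply (disc_expansion_abs_summable _ g)]; assumption.
- unfold r; rewrite sqrt_sqrt by apply Cmod_ge_0; lra.
Qed.

Definition shifted_coef (alpha M : R) (a b : nat -> C) (e : C) (n : nat) : C :=
  (op_coef alpha a n + e * op_coef alpha b n + const_coef (RtoC M) n)%C.

Lemma shifted_coef_pos (alpha M : R) (a b : nat -> C) (h g : C -> C) (e : C) :
  disc_expansion a h -> disc_expansion b g -> a 1%nat = RtoC 1 -> b 1%nat = RtoC 0 ->
  (forall z, unit_disc z -> Re (op alpha h z) > - M + Cmod (op alpha g z)) ->
  Cmod e = 1 ->
  disc_expansion (shifted_coef alpha M a b e)
    (fun z => op alpha h z + e * op alpha g z + RtoC M)%C /\
  shifted_coef alpha M a b e 0 = RtoC (M - alpha + 1) /\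
  forall z, unit_disc z -> 0 < Re (op alpha h z + e * op alpha g z + RtoC M)%C.
Proof.
intros Ha Hb a1 b1 Hineq He; split; [|split].
- intros z Hz; apply is_pseries_C_plus; [apply is_pseries_C_plus|].
  + apply op_expansion; assumption.
  + apply is_pseries_C_scal, op_expansion; assumption.
  + apply is_pseries_const.
- unfold shifted_coef, op_coef, weight, const_coef; rewrite a1, b1.
  replace ((INR 0 + 1) * (1 + alpha * (INR 0 - 1))) with (1 - alpha) by (simpl; ring).
  rewrite RtoC_plus, !RtoC_minus; ring.
- intros z Hz; rewrite !re_plus, re_RtoC.
  assert (H := re_le_Cmod (e * op alpha g z)%C).
  rewrite Cmod_mult, He, Rmult_1_l in H; apply Rabs_le_between in H.
  generalize (Hineq z Hz); lra.
Qed.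

Lemma unimodular_opposite (q : C) : exists e : C, Cmod e = 1 /\ (e * q = - RtoC (Cmod q))%C.
Proof.
destruct (Req_dec (Cmod q) 0) as [E|E].
- exists (RtoC 1); split; [apply Cmod_1|].
  rewrite E; apply Cmod_eq_0 in E; rewrite E; ring.
- assert (Hq : RtoC (Cmod q) <> 0%C) by (apply RtoC_neq_0, E).
  exists (- (Cconj q / RtoC (Cmod q)))%C; split.
  + rewrite Cmod_opp, Cmod_div, Cmod_conj, (Cmod_R_pos (Cmod q)) by (apply Cmod_ge_0 || exact Hq).
    field; exact E.
  + replace (- (Cconj q / RtoC (Cmod q)) * q)%C with (- ((q * Cconj q) / RtoC (Cmod q)))%C
      by (field; exact Hq).
    rewrite <- Cmod2_conj, RtoC_pow; simpl; field; exact Hq.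
Qed.

Theorem theorem3p2 (M alpha : R) (hM : (0 < M)%R)
  (halpha0 : (0 < alpha)%R) (halpha1 : (alpha <= 1)%R)
  (hle : (M - alpha + 1 <= 3 * (1 + alpha) / (6 * alpha + 4))%R)
  (F1 F2 : C -> C)
  (hF1 : class_P0H alpha M F1) (hF2 : class_P0H alpha M F2) :
  class_P0H alpha M (hconv F1 F2).
Proof.
destruct (class_P0H_coeffs alpha M F1 hF1)
  as [Ha1 [Hb1 [a10 [a11 [b10 [b11 Hineq1]]]]]].
destruct (class_P0H_coeffs alpha M F2 hF2)
  as [Ha2 [Hb2 [a20 [a21 [b20 [b21 Hineq2]]]]]].
assert (HH := hadamard_expansion _ _ Ha1 Ha2).
assert (HG := hadamard_expansion _ _ Hb1 Hb2).
exists (hadamard (fst (parts F1)) (fst (parts F2))),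
  (hadamard (snd (parts F1)) (snd (parts F2))).
set (h1 := fst (parts F1)) in *; set (g1 := snd (parts F1)) in *.
set (h2 := fst (parts F2)) in *; set (g2 := snd (parts F2)) in *.
set (H := hadamard h1 h2) in *; set (G := hadamard g1 g2) in *.
set (a1 := disc_coeffs h1) in *; set (b1 := disc_coeffs g1) in *.
set (a2 := disc_coeffs h2) in *; set (b2 := disc_coeffs g2) in *.
split; [|split].
- split; [exact (disc_expansion_analytic _ _ HH)|].
  split; [exact (disc_expansion_analytic _ _ HG)|].
  split; [rewrite <- (disc_expansion_at_0 _ _ HH), a10; ring|].
  split; [rewrite <- (disc_expansion_C_derive_0 _ _ HH), a11, a21; ring|].
  split; [rewrite <- (disc_expansion_at_0 _ _ HG), b10; ring|].
  intros z _; reflexivity.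
- rewrite <- (disc_expansion_C_derive_0 _ _ HG), b11; ring.
- intros z Hz; change (Re (op alpha H z) > - M + Cmod (op alpha G z)).
  (* This [e] turns the modulus in the goal into a real part: [e * op alpha G z] is
     [- Cmod (op alpha G z)]. *)
  destruct (unimodular_opposite (op alpha G z)) as [e [He Heq]].
  set (k := M - alpha + 1) in *.
  assert (Hk : 0 < k) by (unfold k; lra).
  assert (Hk2 : k * (6 * alpha + 4) <= 3 * (1 + alpha)) by (apply Rle_div_r; lra).
  assert (Hme : Cmod (- e)%C = 1) by (rewrite Cmod_opp; exact He).
  (* The signs are paired as 1 with [e] and -1 with [- e], so that the mixed products of analytic
     and co-analytic coefficients cancel in the sum. *)
  destruct (shifted_coef_pos alpha M a1 b1 h1 g1 1 Ha1 Hb1 a11 b11 Hineq1 Cmod_1)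
    as [HU [HU0 HUp]].
  destruct (shifted_coef_pos alpha M a2 b2 h2 g2 e Ha2 Hb2 a21 b21 Hineq2 He)
    as [HV [HV0 HVp]].
  destruct (shifted_coef_pos alpha M a1 b1 h1 g1 (- (1))%C Ha1 Hb1 a11 b11 Hineq1 Cmod_m1)
    as [HU' [HU0' HUp']].
  destruct (shifted_coef_pos alpha M a2 b2 h2 g2 (- e)%C Ha2 Hb2 a21 b21 Hineq2 Hme)
    as [HV' [HV0' HVp']].
  destruct (conv_pos alpha k _ _ _ _ z (conj halpha0 halpha1) Hk Hk2 HU HV HU0 HV0 HUp HVp Hz)
    as [w [Hw Hwp]].
  destruct (conv_pos alpha k _ _ _ _ z (conj halpha0 halpha1) Hk Hk2 HU' HV' HU0' HV0' HUp' HVp' Hz)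
    as [w' [Hw' Hwp']].
  assert (Hsum : is_pseries (fun n => quot_coef alpha (shifted_coef alpha M a1 b1 1)
      (shifted_coef alpha M a2 b2 e) n + quot_coef alpha (shifted_coef alpha M a1 b1 (- (1))%C)
      (shifted_coef alpha M a2 b2 (- e)%C) n)%C z
      (2 * (op alpha H z + e * op alpha G z - RtoC (1 - alpha)))%C).
  { assert (H3 := is_pseries_C_scal 2 _ _ _ (is_pseries_C_minus _ _ _ _ _
      (is_pseries_C_plus _ _ _ _ _ (op_expansion alpha _ _ HH z Hz)
        (is_pseries_C_scal e _ _ _ (op_expansion alpha _ _ HG z Hz)))
      (is_pseries_const (RtoC (1 - alpha)) z))).
    apply is_pseries_C_ext with (2 := H3); intros [|n].
    (* Both quotients are 0 at index 0, whereas the operator applied to [H] has constant term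
       [1 - alpha], which the left side subtracts. *)
    - unfold op_coef, const_coef, quot_coef, weight; rewrite a11, a21, b11, b21.
      replace ((INR 0 + 1) * (1 + alpha * (INR 0 - 1))) with (1 - alpha) by (simpl; ring).
      ring.
    - unfold quot_coef, shifted_coef, op_coef, const_coef.
      assert (Hl := weight_pos alpha (S n) halpha0 ltac:(lia)).
      rewrite RtoC_inv by lra; field; apply RtoC_neq_0; lra. }
  assert (Hww := is_pseries_C_unique _ _ _ _ Hsum (is_pseries_C_plus _ _ _ _ _ Hw Hw')).
  apply (f_equal Re) in Hww.
  rewrite Heq in Hww; unfold Cminus in Hww.
  rewrite re_scal_l, !re_plus, !re_opp, !re_RtoC in Hww.
  assert (Hs : sqrt (Cmod z) < 1).
  { rewrite <- sqrt_1; apply sqrt_lt_1_alt; split; [apply Cmod_ge_0|exact Hz]. }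
  (* Adding the two bounds and using [k = M - alpha + 1] gives [- M] plus two thirds of this
     quantity as a lower bound for [Re (op alpha H z) - Cmod (op alpha G z)], whence the strict
     inequality. *)
  assert (Hkk : 0 < k * k * (1 - sqrt (Cmod z))) by (repeat apply Rmult_lt_0_compat; lra).
  unfold k in Hwp at 1; unfold k in Hwp' at 1.
  nra.
Qed.
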